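(* Suppose $(V,H,E,\Theta)$ is a varifold with enclosed volume, $\theta^2(\mu_V,x)\ge1$ for $\mu_V$-almost all $x$, $\operatorname{spt}\mu_V$ is connected, and $c_0\le0$. If $\mathcal{H}_{c_0}(V)<\infty$, $\mu_V(\mathbb{R}^3)<\infty$, $\Theta\in L^1(\mathcal{L}^3\llcorner E)$, and $$\int_E\frac{\Theta(x)}{|x-x_0|^2}\,d\mathcal{L}^3(x)<\infty\qquad\text{for }\mu_V\text{-almost all }x_0,$$ then $\operatorname{spt}\mu_V$ is compact and $$\operatorname{diam}\operatorname{spt}\mu_V\le C\sqrt{\mathcal{H}_{c_0}(V)\left(\mu_V(\mathbb{R}^3)+\tfrac23|c_0|\mathcal{V}(V)\right)},$$ where $C=\frac{9}{2\pi}$ and $\mathcal{V}(V)=\int_E\Theta\,d\mathcal{L}^3$ is the algebraic volume.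
   Context: $\mathbb{G}^{\mathrm o}(3,2)=\{\xi\in\bigwedge_2\mathbb{R}^3:\ \xi\text{ simple},\ |\xi|=1\}$; $T(\xi)=\{v\in\mathbb{R}^3:v\wedge\xi=0\}$; $\star\xi\in\mathbb{S}^2$ is the Hodge dual ($\star(v_1\wedge v_2)=v_1\times v_2$). An oriented $2$-varifold on $\mathbb{R}^3$ is a Radon measure $V$ on $\mathbb{G}_2^{\mathrm o}(\mathbb{R}^3)=\mathbb{R}^3\times\mathbb{G}^{\mathrm o}(3,2)$ (set of these: $\mathbb{V}_2^{\mathrm o}(\mathbb{R}^3)$), with weight measure $\mu_V$ the push forward of $V$ to $\mathbb{R}^3$, and first variation $\delta V(X)=\int\operatorname{div}_{T(\xi)}X(x)\,dV(x,\xi)$, where $\operatorname{div}_TX=\sum_{j=1}^2\langle e_j,DX\,e_j\rangle$ for an orthonormal basis $e_1,e_2$ of $T$. $(V,H,E,\Theta)$ is a varifold with enclosed volume if: $V\in\mathbb{V}_2^{\mathrm o}(\mathbb{R}^3)$ and $H\in L^1_{\mathrm{loc}}(\mu_V;\mathbb{R}^3)$ satisfy $\delta V(X)=-\int\langle X,H\rangle\,d\mu_V$ for all $X\in C_c^1(\mathbb{R}^3;\mathbb{R}^3)$ and $H(x)\wedge\star\xi=0$ for $V$-almost all $(x,\xi)$; $E\subset\mathbb{R}^3$ is $\mathcal{L}^3$-measurable; $\Theta\in L^1_{\mathrm{loc}}(\mathcal{L}^3\llcorner E;\mathbb{N})$ with $\mathbb{N}=\{1,2,\dots\}$; $\operatorname{diam}\operatorname{spt}(\mathcal{L}^3\llcorner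 E)\le\operatorname{diam}\operatorname{spt}\mu_V$; and $-\int_{\mathbb{G}_2^{\mathrm o}(\mathbb{R}^3)}\langle X(x),\star\xi\rangle\,dV(x,\xi)=\int_E(\operatorname{div}X)\,\Theta\,d\mathcal{L}^3$ for all Lipschitz $X\colon\mathbb{R}^3\to\mathbb{R}^3$ with compact support. The Helfrich energy is $\mathcal{H}_{c_0}(V)=\frac14\int|H(x)-c_0(\star\xi)|^2\,dV(x,\xi)$; the density is $\theta^2(\mu_V,x)=\lim_{\rho\to0+}\mu_V(B_\rho(x))/(\pi\rho^2)$ (closed balls). *)

(* Defs.v *)
From HB Require Import structures.
From mathcomp Require Import all_boot all_order all_algebra.
From mathcomp Require Import all_classical all_reals all_analysis.
From mathcomp Require Import measurable_realfun.
Set Implicit Arguments.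
Unset Strict Implicit.
Unset Printing Implicit Defensive.
Import Order.TTheory GRing.Theory Num.Theory.
Import numFieldNormedType.Exports.
Local Open Scope classical_set_scope.
Local Open Scope ring_scope.

Notation borel T := (g_sigma_algebraType (@open T)).

Section Euclidean.
Context {R : realType}.
Implicit Types (u v w : 'rV[R]_3) (xi : 'M[R]_3).

Definition dot u v : R := \sum_(i < 3) u 0 i * v 0 i.

(* The library norm `|v| on 'rV[R]_3 is the sup norm; it induces the same
   topology as enorm, but all metric quantities below are Euclidean. *)
Definition enorm v : R := Num.sqrt (dot v v).

Definition ecball v (r : R) : set 'rV[R]_3 := [set w | enorm (w - v) <= r].

(* \bigwedge_2 R^3 is the space of skew-symmetric 3x3 matrices: the entry
   (i, j) is the coefficient on e_i /\ e_j. *)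
Definition wedge u v : 'M[R]_3 := u^T *m v - v^T *m u.

(* The norm for which e_0 /\ e_1, e_0 /\ e_2, e_1 /\ e_2 are orthonormal. *)
Definition bnorm xi : R :=
  Num.sqrt (\sum_(i < 3) \sum_(j < 3 | (i < j)%N) xi i j ^+ 2).

(* The coefficient of v /\ xi on e_0 /\ e_1 /\ e_2. Indices in 'I_3 are added
   modulo 3. *)
Definition wedge3 v xi : R := \sum_(i < 3) v 0 i * xi (i + 1) (i + 2%:R).

Definition star xi : 'rV[R]_3 := \row_(i < 3) xi (i + 1) (i + 2%:R).

Lemma star_wedge u v : star (wedge u v) =
  \row_(i < 3) (u 0 (i + 1) * v 0 (i + 2%:R) - u 0 (i + 2%:R) * v 0 (i + 1)).
Proof.
apply/rowP => i; rewrite !mxE !big_ord1 !mxE.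
by rewrite [v 0 (i + 1) * _]mulrC.
Qed.

Definition diam (A : set 'rV[R]_3) : \bar R :=
  ereal_sup (0%E |` [set (enorm (x - y))%:E | x in A & y in A]).

End Euclidean.

Section Grassmannian.
Context (R : realType).

Definition simple_bivector (xi : 'M[R]_3) := exists u v, xi = wedge u v.

Definition oriented_planes : set 'M[R]_3 :=
  [set xi | simple_bivector xi /\ bnorm xi = 1].

(* A subspace of the space of bivectors, with the induced topology. *)
Definition Go := set_type oriented_planes.
HB.instance Definition _ := Topological.on Go.

Lemma e01_oriented_plane :
  wedge (delta_mx 0 0) (delta_mx 0 1) \in oriented_planes.
Proof.
rewrite inE; split; first by exists (delta_mx 0 0), (delta_mx 0 1).
rewrite /bnorm /wedge !big_mkcond /= !big_ord_recl !big_ord0 /=.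
rewrite !(big_mkcond (fun j => _ < _)%N) /= !big_ord_recl !big_ord0 /=.
rewrite !mxE !big_ord1 !mxE /= !(mulr0, mul0r, mulr1, subr0, sub0r, addr0, add0r).
by rewrite !expr2 !(mulr0, mulr1, addr0) sqrtr1.
Qed.

HB.instance Definition _ := isPointed.Build Go
  (exist (fun xi => xi \in oriented_planes) _ e01_oriented_plane).

End Grassmannian.

Section Lebesgue.
Context (R : realType).

Lemma measurable_rV3 d (T : measurableType d) (f : T -> 'rV[R]_3) :
  (forall i, measurable_fun setT (fun t => f t 0 i : measurableTypeR R)) ->
  measurable_fun setT (f : T -> borel 'rV[R]_3).
Proof.
move=> mf; apply: (@measurability _ _ _ (borel 'rV[R]_3) _ _ open) => //.
move=> _ [U oU <-]; rewrite setTI.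
pose box (p : {ffun 'I_3 -> rat} * nat) : set 'rV[R]_3 :=
  [set v | forall i, ball (ratr (p.1 i) : R) p.2.+1%:R^-1 (v 0 i)].
have mbox p : measurable (f @^-1` box p).
  rewrite [X in measurable X](_ : _ =
    \bigcap_(i in [set: 'I_3]) (setT `&` (fun t => f t 0 i) @^-1`
       ball (ratr (p.1 i) : R) p.2.+1%:R^-1)); last first.
    by apply/seteqP; split => t /= H i //; [move=> _; split => //; exact: H
      | have [] := H i I].
  apply: fin_bigcap_measurable => //.
  by move=> i _; apply: mf => //; apply: open_measurable; exact: ball_open.
rewrite [X in measurable X](_ : _ = \bigcup_p
   (if pselect (box p `<=` U) then f @^-1` box p else set0)); last first.
  apply/seteqP; split => [t /= Uft|t [p _]]; last first.
    by case: pselect => // pU /pU.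
  have /nbhs_ballP[e /= e0 eU] : nbhs (f t) U by exact: open_nbhs_nbhs.
  have [n ne] : exists n : nat, n.+1%:R^-1 < e / 2.
    exists (Num.truncn (e / 2)^-1).
    by rewrite invf_plt ?posrE ?divr_gt0// truncnS_gt// invr_ge0 divr_ge0// ltW.
  have n0 : 0 < n.+1%:R^-1 :> R by [].
  have [q qP] : exists q : {ffun 'I_3 -> rat},
      forall i, ball (ratr (q i) : R) n.+1%:R^-1 (f t 0 i).
    have H i : exists r : rat, ball (ratr r : R) n.+1%:R^-1 (f t 0 i).
      have : f t 0 i - n.+1%:R^-1 < f t 0 i + n.+1%:R^-1.
        by rewrite ltrD2l gtrN.
      move=> /rat_in_itvoo[r]; rewrite in_itv/= => /andP[r1 r2].
      exists r; rewrite /ball /= ltr_norml ltrBlDl r2 andbT.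
      by rewrite ltrBrDr addrC.
    exists [ffun i => projT1 (cid (H i))] => i.
    by rewrite ffunE; case: cid.
  exists (q, n) => //; case: pselect => [_ i|[]]; first exact: qP.
  move=> v /= vb; apply: eU; split => // i j.
  rewrite ord1 [e]splitr; apply: (@ball_triangle _ _ (ratr (q j) : R)).
    by apply/ball_sym/(le_ball (ltW ne))/qP.
  exact/(le_ball (ltW ne))/vb.
apply: countable_bigcupT_measurable; first exact: countableP.
by move=> p; case: pselect => ?; [exact: mbox|exact: measurable0].
Qed.

Definition row3 (p : measurableTypeR R * measurableTypeR R * measurableTypeR R)
  : borel 'rV[R]_3 := \row_(i < 3) [:: p.1.1; p.1.2; p.2]`_i.

Lemma measurable_row3 : measurable_fun setT row3.
Proof.
apply: measurable_rV3 => i; rewrite /row3.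
under eq_fun do rewrite mxE.
case: i => -[|[|[|//]]] /= _.
- exact: (measurableT_comp measurable_fst measurable_fst).
- exact: (measurableT_comp measurable_snd measurable_fst).
- exact: measurable_snd.
Qed.

Definition borel_lebesgue3 : set (borel 'rV[R]_3) -> \bar R :=
  pushforward
    ((lebesgue_measure \x lebesgue_measure)%E \x lebesgue_measure)%E row3.
HB.instance Definition _ := Measure.copy borel_lebesgue3
  (measure_function_pushforward__canonical__measure_function_Measure
     ((lebesgue_measure \x lebesgue_measure)%E \x lebesgue_measure)%E
     measurable_row3).

(* The carrier 'rV[R]_3 with the sigma-algebra of Lebesgue measurable sets, and
   the (complete) Lebesgue measure on it. *)
Definition lebesgue3_type := caratheodory_type (borel_lebesgue3^*)%mu.
Definition lebesgue3 : set lebesgue3_type -> \bar R :=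
  @completed_measure_extension _ _ _ borel_lebesgue3.
HB.instance Definition _ := Measurable.on lebesgue3_type.
HB.instance Definition _ := Measure.on lebesgue3.

End Lebesgue.

Section MeasuresOnTopologicalSpaces.
Context (R : realType) (T : ptopologicalType).

Definition Radon (mu : {measure set (borel T) -> \bar R}%E) := [/\
  forall K : set T, compact K -> (mu K < +oo)%E,
  forall U : set T, open U ->
    mu U = ereal_sup [set mu K | K in [set K : set T | compact K /\ K `<=` U]] &
  forall A : set (borel T), measurable A ->
    mu A = ereal_inf [set mu U | U in [set U : set T | open U /\ A `<=` U]]].

(* The complement of the largest open null set. *)
Definition spt (mu : set T -> \bar R) : set T :=
  ~` \bigcup_(U in [set U | open U /\ mu U = 0%E]) U.

End MeasuresOnTopologicalSpaces.

Section TestFields.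
Context {R : realType}.
Implicit Types (X : 'rV[R]_3 -> 'rV[R]_3) (T : set 'rV[R]_3).

Definition compactly_supported X := compact (closure [set x | X x != 0]).

Definition C1c X := [/\ forall x, differentiable X x,
  continuous (fun x => 'J X x) & compactly_supported X].

Definition Lipschitz_c X := lipschitz X /\ compactly_supported X.

(* For Lipschitz X this is meaningful almost everywhere. *)
Definition divergence X (x : 'rV[R]_3) : R := \tr ('J X x).

(* The rows of e form an orthonormal basis of T. *)
Definition orthonormal_basis2 T (e : 'M[R]_(2, 3)) :=
  e *m e^T = 1%:M /\ T = [set v | (v <= e)%MS].

(* The value does not depend on the basis picked by xget. *)
Definition tangential_divergence T X (x : 'rV[R]_3) : R :=
  let e := xget 0 (orthonormal_basis2 T) in
  \sum_(j < 2) dot (row j e) ('d X x (row j e)).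

End TestFields.

Section Varifolds.
Context (R : realType).

Definition G2o := ('rV[R]_3 * Go R)%type.
HB.instance Definition _ := Topological.on G2o.
HB.instance Definition _ := Pointed.on G2o.

Definition tangent_plane (xi : Go R) : set 'rV[R]_3 :=
  [set v | wedge3 v (sval xi) = 0].

Lemma measurable_fst_borel :
  measurable_fun setT (fst : borel G2o -> borel 'rV[R]_3).
Proof.
apply: (@measurability _ _ _ (borel 'rV[R]_3) _ _ open) => //.
move=> _ [U oU <-]; rewrite setTI; apply: sub_sigma_algebra.
by apply: open_comp => // z _; exact: cvg_fst.
Qed.

Definition weight (V : {measure set (borel G2o) -> \bar R}%E) :
    set (borel 'rV[R]_3) -> \bar R :=
  pushforward V (fst : borel G2o -> borel 'rV[R]_3).
HB.instance Definition _ V := Measure.copy (weight V)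
  (measure_function_pushforward__canonical__measure_function_Measure
     V measurable_fst_borel).

Local Open Scope ereal_scope.
Implicit Types (V : {measure set (borel G2o) -> \bar R})
  (H X : 'rV[R]_3 -> 'rV[R]_3) (E : set (lebesgue3_type R))
  (Theta : lebesgue3_type R -> nat).

Definition first_variation V X : \bar R :=
  \int[V]_z (tangential_divergence (tangent_plane z.2) X z.1)%:E.

(* H is a Borel representative of its class in L^1_loc(weight V; R^3). E and
   Theta are only required to be Lebesgue measurable. *)
Record varifold_with_enclosed_volume V H E Theta : Prop := {
  evol_Radon : Radon V ;
  evol_measurable_H :
    measurable_fun setT (H : borel 'rV[R]_3 -> borel 'rV[R]_3) ;
  evol_locally_integrable_H : forall K : set 'rV[R]_3, compact K ->
    (weight V).-integrable K (fun x => (enorm (H x))%:E) ;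
  evol_first_variation : forall X, C1c X ->
    first_variation V X = - (\int[weight V]_x (dot (X x) (H x))%:E) ;
  evol_normal : {ae V, forall z, wedge (H z.1) (star (sval z.2)) = 0%R} ;
  evol_measurable_E : measurable E ;
  evol_Theta_gt0 : forall x, E x -> (0 < Theta x)%N ;
  evol_measurable_Theta : measurable_fun E Theta ;
  evol_locally_integrable_Theta : forall K : set 'rV[R]_3, compact K ->
    (@lebesgue3 R).-integrable (E `&` K) (fun x => (Theta x)%:R%:E) ;
  evol_diam : diam (spt (fun A : set 'rV[R]_3 => lebesgue3 (A `&` E)))
    <= diam (spt (weight V)) ;
  evol_divergence : forall X, Lipschitz_c X ->
    - (\int[V]_z (dot (X z.1) (star (sval z.2)))%:E) =
    \int[@lebesgue3 R]_(x in E)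
      (divergence X x * (Theta x)%:R)%:E
}.

Definition helfrich V H (c0 : R) : \bar R := (4^-1)%:E *
  \int[V]_z (enorm (H z.1 - c0 *: star (sval z.2)) ^+ 2)%:E.

Definition algebraic_volume E Theta : \bar R :=
  \int[@lebesgue3 R]_(x in E) (Theta x)%:R%:E.

Definition density_ratio (mu : set 'rV[R]_3 -> \bar R) (x : 'rV[R]_3) (rho : R)
    : \bar R :=
  mu (ecball x rho) * ((pi * rho ^+ 2)^-1)%:E.

(* Only meaningful at points where the density ratio converges. *)
Definition density2 mu x : \bar R := lim (density_ratio mu x @ 0^'+).

End Varifolds.

(* Main.v *)
(* Idea: instead of the Lipschitz truncation of x / |x|^2 used for Simon's
   monotonicity formula, test the first variation with the C^1 field
   phi(s) (x - x0), s = |x - x0|^2, phi(s) = (1 - s/q)_+^2 / (s + eps). Since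
   phi^2 <= - phi', the normal part of the divergence absorbs the curvature term,
   and letting the same field act on the enclosed volume gives, without a limit,
     2 int (1 - s/q)_+^2 eps / (s + eps)^2 dmu
       <= (4/q) mu(B) + (1/8) int_B |H - c0 nu|^2 + (4/q) |c0| int_(E cap B) Theta
   on the ball B = {s < q}; the two divergences are bounded below by - 4/q. At a
   point of density at least 1 the left-hand side exceeds (8/5) pi for small eps.
   If p, x in the support are at distance l, connectedness yields M + 1 points of
   the support at distances i l / M from p, and nearby density points are centres
   of M + 1 disjoint balls of radius about l / (2 M). Summing the inequality over these balls and choosing M
   in terms of the energy gives the bound; the losses with respect to the sharp
   constants fit in the gap between 2 / pi and 9 / (2 pi). *)

From HB Require Import structures.
Require Import Defs.
From mathcomp Require Import all_boot all_order all_algebra.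
From mathcomp Require Import all_classical all_reals all_analysis.
From mathcomp Require Import measurable_realfun.
From mathcomp Require Import ring lra.
Import Order.TTheory GRing.Theory Num.Theory.
Import numFieldNormedType.Exports.
Local Open Scope classical_set_scope.
Local Open Scope ring_scope.

(** * Radial fields *)

Section Calculus.
Context {R : realType}.
Implicit Types (f df : R -> R).

(** Expansion in the standard basis reduces the claim to the sum rule and to scalar functions times
    constant vectors, so fields can be differentiated coordinate by coordinate. *)
Lemma is_diff_row {V : normedModType R} {n} (f df : V -> 'rV[R]_n) (x : V) :
  (forall i, is_diff x (fun z => f z 0 i) (fun v => df v 0 i)) ->
  is_diff x f df.
Proof.
move=> fi.
have rowE (g : V -> 'rV[R]_n) :
    g = \sum_(i < n) (fun z => g z 0 i *: (delta_mx 0 i : 'rV[R]_n)).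
  by apply/funext => z; rewrite fct_sumE {1}[g z]row_sum_delta.
rewrite (rowE f) (rowE df).
apply: (big_ind2 (fun g dg : V -> 'rV[R]_n => is_diff x g dg)).
- exact: is_diff_cst.
- by move=> *; exact: is_diffD.
- move=> i _; have [dfi dfiE] := fi i.
  by apply: DiffDef; [exact: differentiableZl|rewrite diffZl// dfiE].
Qed.

Lemma is_diff_coord n (x : 'rV[R]_n) i :
  is_diff x (fun z : 'rV[R]_n => z 0 i : R) (fun v => v 0 i).
Proof.
have coord_linear : linear (fun z : 'rV[R]_n => z 0 i : R).
  by move=> a u v; rewrite !mxE.
pose L := GRing.isLinear.Build _ _ _ _ _ coord_linear.
pose f : {linear 'rV[R]_n -> R} := HB.pack (fun z : 'rV[R]_n => z 0 i : R) L.
apply: DiffDef; first exact: differentiable_coord.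
by apply: (@diff_lin _ _ _ f x) => y; exact: coord_continuous.
Qed.

Lemma is_diff_sqdist (x0 x : 'rV[R]_3) :
  is_diff x (fun z => dot (z - x0) (z - x0)) (fun v : 'rV[R]_3 => 2 * dot (x - x0) v).
Proof.
have -> : (fun z => dot (z - x0) (z - x0)) =
    \sum_(i < 3) ((fun z : 'rV[R]_3 => z 0 i : R) - cst (x0 0 i)) ^+ 2.
  apply/funext => z; rewrite fct_sumE /dot; apply: eq_bigr => i _.
  by rewrite !mxE expr2.
have -> : (fun v : 'rV[R]_3 => 2 * dot (x - x0) v) =
    \sum_(i < 3) (fun v : 'rV[R]_3 => 2 * (x - x0) 0 i * v 0 i).
  apply/funext => v; rewrite fct_sumE /dot mulr_sumr.
  by apply: eq_bigr => i _; rewrite mulrA.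
apply: (big_ind2 (fun g dg : 'rV[R]_3 -> R => is_diff x g dg)).
- exact: is_diff_cst.
- by move=> *; exact: is_diffD.
- move=> i _; have := is_diff_coord 3 x i => ?.
  apply: is_diff_eq; apply/funext => v.
  rewrite subr0 /= -[(_ *: _) v]/(_ * _) !mxE expr1.
  by [].
Qed.

Lemma is_derive_is_diff f (s d : R) :
  is_derive s 1 f d -> is_diff s f (fun v => d * v).
Proof.
move=> [fs fd]; have := fs => /derivable1_diffP dfs.
by apply: DiffDef => //; rewrite deriv1E// derive1E fd; apply/funext => v /=;
  rewrite mulrC.
Qed.

(** [f] is evaluated at the squared distance, which is smooth at [x0] as well, so the centre needs
    no separate treatment. *)
Definition radial f (x0 x : 'rV[R]_3) : 'rV[R]_3 :=
  f (dot (x - x0) (x - x0)) *: (x - x0).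

(** The chain and product rules give a differential of the form [a *: v + (b * dot y v) *: y], from
    which both divergences are read off later. *)
Lemma is_diff_radial f df x0 x :
  is_derive (dot (x - x0) (x - x0)) 1 f (df (dot (x - x0) (x - x0))) ->
  is_diff x (radial f x0) (fun v => f (dot (x - x0) (x - x0)) *: v +
    (2 * df (dot (x - x0) (x - x0)) * dot (x - x0) v) *: (x - x0)).
Proof.
move=> fs; set s := dot _ _ in fs *; apply: is_diff_row => i.
have := is_diff_coord 3 x i => ci.
have := is_diff_sqdist x0 x => cs.
have /is_derive_is_diff fsd := fs.
have fcs : is_diff x (f \o fun z => dot (z - x0) (z - x0))
  ((fun v => df s * v) \o (fun v : 'rV[R]_3 => 2 * dot (x - x0) v)).
  exact: is_diff_comp.
rewrite (_ : (fun z => _) = (f \o fun z => dot (z - x0) (z - x0)) *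
  ((fun z : 'rV[R]_3 => z 0 i : R) - cst (x0 0 i))); last first.
  by apply/funext => z; rewrite !mxE.
apply: is_diff_eq; apply/funext => v.
rewrite subr0 -![(_ + _) v]/(_ + _) -![(_ *: _) v]/(_ * _) !mxE /=.
rewrite -/s; congr (_ + _); rewrite [LHS]mulrC; congr (_ * _).
by rewrite mulrCA mulrA.
Qed.

End Calculus.

(** * The squared positive part *)

Section Ramp.
Context {R : realType}.

(** The remainder stays quadratic across the kink of the positive part, since squaring makes the
    function continuously differentiable there. *)
Lemma ramp2_expansion (y h : R) :
  `|Num.max 0 (y + h) ^+ 2 - Num.max 0 y ^+ 2 - 2 * Num.max 0 y * h| <= h ^+ 2.
Proof.
rewrite ler_norml.
by case: (leP 0 (y + h)) => ?; case: (leP 0 y) => ?; apply/andP; split; nra.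
Qed.

Lemma is_derive_ramp2 (y : R) :
  is_derive y 1 (fun z => Num.max 0 z ^+ 2) (2 * Num.max 0 y).
Proof.
have c : (fun h => h^-1 *: (((fun z => Num.max 0 z ^+ 2) \o shift y) (h *: 1)
    - Num.max 0 y ^+ 2)) @ 0^' --> 2 * Num.max 0 y.
  apply/cvgrPdist_le => e e0; near=> h.
  have h0 : h != 0 by near: h; exact: nbhs_dnbhs_neq.
  have he : `|h| <= e by near: h; apply: dnbhs0_le.
  (* After multiplication by [|h|] the remainder h^2 only has to be at most e |h|. *)
  rewrite -(@ler_pM2l _ `|h|) ?normr_gt0// -normrM /= mulrBr.
  rewrite [h *: 1]mulr1 [_ *: _]/(_ * _) mulVKf// distrC [h + y]addrC.
  rewrite [h * (2 * _)]mulrC (le_trans (ramp2_expansion _ _))//.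
  by rewrite -real_normK ?num_real// expr2 ler_wpM2l.
by split; [apply/cvg_ex; eexists; exact: c|exact: cvg_lim].
Unshelve. all: by end_near. Qed.

End Ramp.

(** * The cut-off profile and its estimates *)

Section Profile.
Context {R : realType} (q eps : R).
Context (q0 : 0 < q) (eps0 : 0 < eps).

(** [q] is the squared radius of the ball, and [eps] regularises the kernel 1/s at the centre. Only
    [s >= 0] matters, where the denominator is positive. *)
Definition profile (s : R) := Num.max 0 (1 - s / q) ^+ 2 / (s + eps).

Definition dprofile (s : R) :=
  - (2 / q * Num.max 0 (1 - s / q) / (s + eps) +
     Num.max 0 (1 - s / q) ^+ 2 / (s + eps) ^+ 2).

Lemma is_derive_profile (s : R) : 0 <= s ->
  is_derive s 1 profile (dprofile s).
Proof.
move=> s0; have se0 : s + eps != 0 by rewrite gt_eqF// ltr_wpDl.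
have dr := is_derive_ramp2 (1 - s / q).
have dl : is_derive s 1 (fun z : R => 1 - z / q) (- q^-1).
  rewrite (_ : (fun z : R => _) = cst 1 - q^-1 \*: id); last first.
    by apply/funext => z; rewrite mulrC.
  by apply: is_derive_eq; rewrite sub0r [_ *: _]mulr1.
have dm : is_derive s 1 (fun z : R => Num.max 0 (1 - z / q) ^+ 2)
    (- q^-1 * (2 * Num.max 0 (1 - s / q))).
  rewrite mulrC.
  exact: (@is_derive1_comp _ _ (fun z => 1 - z / q) _ _ _ dr dl).
have di : is_derive s 1 (fun z : R => (z + eps)^-1) (- (s + eps) ^- 2).
  have ds : is_derive s 1 (fun z : R => z + eps) 1.
    rewrite (_ : (fun z : R => _) = id + cst eps)//.
    by apply: is_derive_eq; rewrite addr0.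
  by have := @is_deriveV _ (fun z : R => z + eps) _ _ _ se0 ds; rewrite [_ *: _]mulr1.
apply: (is_derive_eq (is_deriveM dm di)).
rewrite /dprofile -![_ *: _]/(_ * _).
by set m := Num.max _ _; field; rewrite se0 gt_eqF.
Qed.

Lemma continuous_dprofile (s : R) : 0 <= s -> {for s, continuous dprofile}.
Proof.
move=> s0; have se0 : s + eps != 0 by rewrite gt_eqF// ltr_wpDl.
have cr : {for s, continuous (fun z : R => Num.max 0 (1 - z / q))}.
  have c1 : {for s, continuous (fun z : R => 1 - z / q : R^o)}.
    apply: cvgB; first exact: cvg_cst.
    by apply: cvgMr_tmp; exact: cvg_id.
  by have := continuous_max (@cst_continuous R R^o 0 s) c1.
have ci : {for s, continuous (fun z : R => (z + eps)^-1)}.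
  by apply: cvgV => //; apply: cvgD; [exact: cvg_id|exact: cvg_cst].
rewrite (_ : dprofile = (fun z => - (2 / q * Num.max 0 (1 - z / q) *
    (z + eps)^-1 + (Num.max 0 (1 - z / q) * Num.max 0 (1 - z / q)) *
    ((z + eps)^-1 * (z + eps)^-1)))).
  apply: continuousN; apply: continuousD.
    by apply: continuousM => //; apply: continuousM => //; exact: cst_continuous.
  by apply: continuousM; exact: continuousM.
by apply/funext => z; rewrite -!expr2 exprVn.
Qed.

Lemma profile_out (s : R) : q <= s -> profile s = 0 /\ dprofile s = 0.
Proof.
move=> qs; rewrite /profile /dprofile.
have -> : Num.max 0 (1 - s / q) = 0.
  by apply/max_idPl; rewrite subr_le0 ler_pdivlMr// mul1r.
by rewrite expr2 !(mulr0, mul0r) addr0 oppr0.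
Qed.

Let ramp_bounds (s : R) : 0 <= s -> 0 <= Num.max 0 (1 - s / q) <= 1.
Proof.
move=> s0; rewrite le_max lexx/= ge_max ler01/= gerBl.
by rewrite divr_ge0// ltW.
Qed.

Lemma profile_ge0 (s : R) : 0 <= s -> 0 <= profile s.
Proof. by move=> s0; rewrite divr_ge0 ?sqr_ge0 ?addr_ge0// ltW. Qed.

Lemma profile_le (s : R) : 0 <= s -> profile s <= eps^-1.
Proof.
move=> s0; have se0 : 0 < s + eps by rewrite ltr_wpDl.
rewrite -[leRHS]mul1r ler_pM ?sqr_ge0 ?invr_ge0 ?(ltW se0)//.
  by have /andP[? ?] := ramp_bounds _ s0; rewrite exprn_ile1.
by rewrite lef_pV2 ?posrE// lerDr.
Qed.

(** In the differential of the field the derivative comes with two factors of length sqrt s;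
    bounding the product gives the Lipschitz constant and the integrability of the divergences. *)
Lemma dprofile_le (s : R) : 0 <= s -> `|dprofile s| * s <= 2 / q + eps^-1.
Proof.
move=> s0; have /andP[] := ramp_bounds _ s0.
rewrite /dprofile; set m := Num.max _ _ => m0 m1.
have se0 : 0 < s + eps by rewrite ltr_wpDl.
have q20 : 0 <= 2 / q by rewrite divr_ge0// ltW.
rewrite normrN ger0_norm; last first.
  by apply: addr_ge0; apply: mulr_ge0;
    rewrite ?mulr_ge0 ?invr_ge0 ?sqr_ge0 ?(ltW se0) ?(ltW q0).
have u1 : s / (s + eps) <= 1 by rewrite ler_pdivrMr// mul1r lerDl ltW.
have u0 : 0 <= s / (s + eps) by rewrite divr_ge0// ltW.
have v0 : (s + eps)^-1 <= eps^-1 by rewrite lef_pV2 ?posrE// lerDr.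
have -> : (2 / q * m / (s + eps) + m ^+ 2 / (s + eps) ^+ 2) * s =
    2 / q * (m * (s / (s + eps))) + m ^+ 2 * (s / (s + eps)) * (s + eps)^-1.
  by field; rewrite !gt_eqF.
apply: lerD.
  by rewrite -[leRHS]mulr1 ler_wpM2l// mulr_ile1.
rewrite -[leRHS]mul1r ler_pM ?mulr_ge0 ?sqr_ge0 ?invr_ge0 ?(ltW se0)//.
by rewrite mulr_ile1 ?sqr_ge0// exprn_ile1.
Qed.

(** The second summand of [- dprofile] is enough, since m^4 <= m^2 for a ramp value m in [0, 1].
    This is what makes completing the square possible in [integrand_ge]. *)
Lemma sqr_profile_le (s : R) : 0 <= s -> profile s ^+ 2 <= - dprofile s.
Proof.
move=> s0; have /andP[] := ramp_bounds _ s0.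
rewrite /profile /dprofile opprK; set m := Num.max _ _ => m0 m1.
have se0 : 0 < s + eps by rewrite ltr_wpDl.
rewrite -[leLHS]add0r lerD ?mulr_ge0 ?invr_ge0 ?(ltW q0) ?(ltW se0)//.
rewrite expr_div_n ler_pM2r ?invr_gt0 ?exprn_gt0//.
by rewrite -[leRHS]mulr1 [leLHS]expr2 ler_wpM2l ?sqr_ge0// exprn_ile1.
Qed.

(** The right-hand side is the divergence of the field along a plane through the centre. The
    singular parts cancel up to eps / (s + eps)^2, and the cut-off costs 4/q times a factor at most
    1. *)
Lemma planar_divergence_ge (s : R) : 0 <= s -> s < q ->
  2 * (Num.max 0 (1 - s / q) ^+ 2 * (eps / (s + eps) ^+ 2)) - 4 / q <=
  2 * profile s + 2 * dprofile s * s.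
Proof.
move=> s0 sq; have /andP[] := ramp_bounds _ s0.
rewrite /profile /dprofile; set m := Num.max _ _ => m0 m1.
have se0 : 0 < s + eps by rewrite ltr_wpDl.
have -> : 2 * (m ^+ 2 / (s + eps)) +
    2 * - (2 / q * m / (s + eps) + m ^+ 2 / (s + eps) ^+ 2) * s =
    2 * (m ^+ 2 * (eps / (s + eps) ^+ 2)) - 4 / q * (m * (s / (s + eps))).
  by field; rewrite !gt_eqF.
rewrite lerB// -[leRHS]mulr1 ler_wpM2l ?divr_ge0// ?(ltW q0)//.
rewrite mulr_ile1// ?divr_ge0// ?(ltW se0)//.
by rewrite ler_pdivrMr// mul1r lerDl ltW.
Qed.

(** The full divergence exceeds the planar one by [profile], which is nonnegative. *)
Lemma space_divergence_ge (s : R) : 0 <= s -> s < q ->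
  - (4 / q) <= 3 * profile s + 2 * dprofile s * s.
Proof.
move=> s0 sq; have := planar_divergence_ge _ s0 sq.
have := profile_ge0 _ s0; set a := _ - 4 / q.
suff : - (4 / q) <= a by lra.
by rewrite /a lerDr; apply: mulr_ge0 => //; rewrite mulr_ge0 ?sqr_ge0// divr_ge0 ?sqr_ge0// ltW.
Qed.

End Profile.

(** * Tangent planes and divergences *)

Section EuclideanGeometry.
Context {R : realType}.
Implicit Types (u v w : 'rV[R]_3) (xi : Go R).

Lemma dotE u v : dot u v = u 0 0 * v 0 0 + u 0 1 * v 0 1 + u 0 2%:R * v 0 2%:R.
Proof.
rewrite /dot !big_ord_recl big_ord0 addr0 addrA.
by congr (_ + _ * _ + _ * _); congr (_ _ _); apply/val_inj.
Qed.

Lemma dot_mulmx u v : u *m v^T = (dot u v)%:M.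
Proof.
rewrite [LHS]mx11_scalar !mxE; congr (_%:M).
by apply: eq_bigr => i _; rewrite mxE.
Qed.

Lemma dotC u v : dot u v = dot v u.
Proof. by rewrite !dotE; ring. Qed.

Lemma dotDr u v w : dot u (v + w) = dot u v + dot u w.
Proof. by rewrite !dotE !mxE; ring. Qed.

Lemma dotZr (a : R) u v : dot u (a *: v) = a * dot u v.
Proof. by rewrite !dotE !mxE; ring. Qed.

Lemma dot_ge0 u : 0 <= dot u u.
Proof. by rewrite dotE -!expr2 !addr_ge0 ?sqr_ge0. Qed.

Lemma sqr_enorm u : enorm u ^+ 2 = dot u u.
Proof. by rewrite sqr_sqrtr ?dot_ge0. Qed.

(** Lagrange's identity: the difference of the two sides is the squared length of the cross
    product. *)
Lemma Cauchy_Schwarz u v : dot u v ^+ 2 <= dot u u * dot v v.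
Proof.
rewrite -subr_ge0 !dotE.
set a := u 0 0; set b := u 0 1; set c := u 0 2%:R.
set a' := v 0 0; set b' := v 0 1; set c' := v 0 2%:R.
have -> : (a * a + b * b + c * c) * (a' * a' + b' * b' + c' * c') -
    (a * a' + b * b' + c * c') ^+ 2 =
    (a * b' - b * a') ^+ 2 + (a * c' - c * a') ^+ 2 + (b * c' - c * b') ^+ 2.
  by ring.
by rewrite !addr_ge0 ?sqr_ge0.
Qed.

Lemma enorm_ge0 u : 0 <= enorm u. Proof. exact: sqrtr_ge0. Qed.

Lemma ler_enormD u v : enorm (u + v) <= enorm u + enorm v.
Proof.
rewrite -(@ler_pXn2r _ 2)// ?nnegrE ?addr_ge0 ?enorm_ge0//.
rewrite sqrrD !sqr_enorm.
have -> : dot (u + v) (u + v) = dot u u + dot u v *+ 2 + dot v v.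
  by rewrite !dotE !mxE; ring.
rewrite lerD2r lerD2l lerMn2r /=.
apply: le_trans (ler_norm _) _.
rewrite -(@ler_pXn2r _ 2)// ?nnegrE ?mulr_ge0 ?enorm_ge0//.
by rewrite real_normK ?num_real// exprMn !sqr_enorm Cauchy_Schwarz.
Qed.

Lemma enormN u : enorm (- u) = enorm u.
Proof. by congr Num.sqrt; rewrite !dotE !mxE; ring. Qed.

Lemma coord_le_enorm u i : `|u 0 i| <= enorm u.
Proof.
rewrite -(@ler_pXn2r _ 2)// ?nnegrE ?enorm_ge0// sqr_enorm real_normK ?num_real//.
rewrite /dot (bigD1 i)//= expr2 lerDl sumr_ge0// => j _.
by rewrite -expr2 sqr_ge0.
Qed.

(** The library norm is the sup norm, so bounds on it can be checked on coordinates; this is how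
    Euclidean estimates are transferred. *)
Lemma row_norm_le n (u : 'rV[R]_n) (K : R) :
  0 <= K -> (forall i, `|u 0 i| <= K) -> `|u| <= K.
Proof.
move=> K0 uK; rewrite /Num.Def.normr /= mx_normrE.
by apply: bigmax_le => // -[i j] _; rewrite ord1.
Qed.

Lemma coord_le_norm n (u : 'rV[R]_n) i : `|u 0 i| <= `|u|.
Proof.
rewrite [leRHS]/Num.Def.normr /= mx_normrE.
exact: (@le_bigmax _ _ _ 0 (fun ij => `|u ij.1 ij.2|) (0, i)).
Qed.

(** Up to sign the coordinates of [star] are the three independent entries of the bivector; the skew
    symmetry comes from its representation as a wedge. *)
Lemma star_unit xi : dot (star (sval xi)) (star (sval xi)) = 1.
Proof.
have /set_mem[[u [v uv]]] := svalP xi; rewrite /bnorm => xi1.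
have : \sum_(i < 3) \sum_(j < 3 | (i < j)%N) sval xi i j ^+ 2 = 1.
  rewrite -[RHS](expr1n _ 2) -xi1 sqr_sqrtr// sumr_ge0// => i _.
  by rewrite sumr_ge0// => j _; rewrite sqr_ge0.
move=> <-; rewrite uv star_wedge dotE !mxE !big_mkcond /= !big_ord_recl !big_ord0.
rewrite /= !(big_mkcond (fun j => _ < _)%N) /= !big_ord_recl !big_ord0 /=.
rewrite !mxE !big_ord1 !mxE /= !addr0 !add0r.
rewrite [1 + 2%:R : 'I_3](_ : _ = 0); last exact/val_inj.
rewrite [2%:R + 1 : 'I_3](_ : _ = 0); last exact/val_inj.
rewrite [2%:R + 2%:R : 'I_3](_ : _ = 1); last exact/val_inj.
rewrite [lift ord0 (lift ord0 ord0)](_ : _ = 2%:R :> 'I_3); last exact/val_inj.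
rewrite [lift ord0 ord0](_ : _ = 1 :> 'I_3); last exact/val_inj.
set a := u 0 0; set b := u 0 1; set c := u 0 2%:R.
set a' := v 0 0; set b' := v 0 1; set c' := v 0 2%:R.
by ring.
Qed.

Lemma tangent_planeE xi : tangent_plane xi = [set v | dot v (star (sval xi)) = 0].
Proof.
apply: eq_set => v; rewrite /wedge3 /dot.
by under [in RHS]eq_bigr do rewrite mxE.
Qed.

Lemma orthonormal_complement (n : 'rV[R]_3) : dot n n = 1 ->
  exists e : 'M[R]_(2, 3), e *m e^T = 1%:M /\ e *m n^T = 0.
Proof.
move=> nn.
have [a [b [aa [bb [ab [an bn]]]]]] : exists a b : 'rV[R]_3,
    dot a a = 1 /\ dot b b = 1 /\ dot a b = 0 /\ dot a n = 0 /\ dot b n = 0.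
  have rowE (x y z : R) : let u : 'rV[R]_3 := \row_(i < 3) [:: x; y; z]`_i in
    (u 0 0 = x) * (u 0 1 = y) * (u 0 2%:R = z) by rewrite /= !mxE.
  pose p := n 0 0 ^+ 2 + n 0 1 ^+ 2.
  (* If the horizontal part of [n] vanishes, the first two standard basis vectors serve. *)
  have [p0|p0] := eqVneq p 0.
    have /andP[/eqP n0 /eqP n1] : (n 0 0 == 0) && (n 0 1 == 0).
      by move/eqP: p0; rewrite paddr_eq0 ?sqr_ge0// !sqrf_eq0.
    exists (\row_(i < 3) [:: 1; 0; 0]`_i), (\row_(i < 3) [:: 0; 1; 0]`_i).
    by rewrite !dotE !rowE n0 n1; do ![split]; ring.
  have {}p0 : 0 < p by rewrite lt_neqAle eq_sym p0 addr_ge0 ?sqr_ge0.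
  pose k := (Num.sqrt p)^-1.
  have kp : k ^+ 2 * p = 1.
    by rewrite exprVn sqr_sqrtr ?ltW// mulVf ?gt_eqF.
  move: nn; rewrite dotE; move: kp; rewrite /p.
  set x := n 0 0; set y := n 0 1; set z := n 0 2%:R => kp nn.
  (* A horizontal unit vector orthogonal to [n], followed by the cross product of [n] with it. *)
  exists (\row_(i < 3) [:: - k * y; k * x; 0]`_i).
  exists (\row_(i < 3) [:: - k * x * z; - k * y * z; k * (x ^+ 2 + y ^+ 2)]`_i).
  rewrite !dotE !rowE -/x -/y -/z; do ![split]; last 3 first.
  - by ring.
  - by ring.
  - by ring.
  - by rewrite -kp; ring.
  - transitivity (k ^+ 2 * (x ^+ 2 + y ^+ 2) * (x * x + y * y + z * z)).
      by ring.
    by rewrite kp nn mulr1.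
exists (\matrix_(j < 2) if j == 0 then a else b); split.
  apply/matrixP => i j; rewrite !mxE.
  under eq_bigr do rewrite !mxE.
  rewrite -/(dot (if i == 0 then a else b) (if j == 0 then a else b)).
  case: i => -[|[|//]] ?; case: j => -[|[|//]] ? /=; rewrite -?val_eqE//=.
  by rewrite dotC.
apply/matrixP => i j; rewrite (ord1 j) !mxE; under eq_bigr do rewrite !mxE.
by rewrite -/(dot (if i == 0 then a else b) n); case: ifP.
Qed.

(** Stacking [e] and [n] gives a square matrix whose transpose is a right inverse, hence also a left
    inverse. Thus [e^T *m e] is the projection onto the plane orthogonal to [n]. *)
Lemma orthonormal_completion (e : 'M[R]_(2, 3)) (n : 'rV[R]_3) :
  e *m e^T = 1%:M -> e *m n^T = 0 -> dot n n = 1 -> e^T *m e = 1%:M - n^T *m n.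
Proof.
move=> ee en nn.
have ne : n *m e^T = 0 by apply: trmx_inj; rewrite trmx_mul trmxK en trmx0.
have : col_mx e n *m (col_mx e n)^T = 1%:M.
  by rewrite tr_col_mx mul_col_row ee en ne dot_mulmx nn -scalar_mx_block.
move=> /mulmx1C; rewrite tr_col_mx mul_row_col => <-.
by rewrite addrK.
Qed.

(** Existence of a basis ensures that [xget] in [tangential_divergence] does not fall back on its
    default [0]. *)
Lemma orthonormal_basis2_tangent_plane xi :
  exists e, orthonormal_basis2 (tangent_plane xi) e.
Proof.
have [e [ee en]] := orthonormal_complement _ (star_unit xi).
exists e; split => //; rewrite tangent_planeE.
have := orthonormal_completion _ _ ee en (star_unit xi).
set n := star _ in en *; move=> ete.
apply/seteqP; split => v /=.
  move=> vn; rewrite -[v]mulmx1 -[1%:M](subrK (n^T *m n)) -ete mulmxDr !mulmxA.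
  by rewrite dot_mulmx vn -scalemx1 scale0r mul0mx addr0 submxMl.
move=> /submxP[D ->].
by have /(congr1 (mulmx D)) := en;
  rewrite mulmxA dot_mulmx mulmx0 => /matrixP/(_ 0 0); rewrite !mxE eqxx.
Qed.

(** For every orthonormal basis the sum is [2 * a] plus [b] times the squared length of the
    projection of [y], and the projection depends only on the normal; hence the choice made by
    [xget] is irrelevant. *)
Lemma tangential_divergenceE xi X x y (a b : R) :
  (forall v, 'd X x v = a *: v + (b * dot y v) *: y) ->
  tangential_divergence (tangent_plane xi) X x =
  2 * a + b * (dot y y - dot y (star (sval xi)) ^+ 2).
Proof.
move=> dX; rewrite /tangential_divergence.
have := xgetPex 0 (orthonormal_basis2_tangent_plane xi).
move: (xget 0 _) => e [ee Te].
have en : e *m (star (sval xi))^T = 0.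
  apply/row_matrixP => j; rewrite row_mul dot_mulmx row0.
  have : tangent_plane xi (row j e) by rewrite Te /=; exact: row_sub.
  by rewrite tangent_planeE /= => ->; rewrite raddf0.
have ete := orthonormal_completion _ _ ee en (star_unit xi).
have rowee (j : 'I_2) : dot (row j e) (row j e) = 1.
  transitivity ((e *m e^T) j j); last by rewrite ee mxE eqxx.
  by rewrite mxE; apply: eq_bigr => k _; rewrite !mxE.
have yee : \sum_(j < 2) dot y (row j e) ^+ 2 =
    dot y y - dot y (star (sval xi)) ^+ 2.
  have /matrixP/(_ 0 0) : y *m (e^T *m e) *m y^T =
      (dot y y - dot y (star (sval xi)) ^+ 2)%:M.
    rewrite ete mulmxBr mulmx1 mulmxBl dot_mulmx !mulmxA dot_mulmx.
    by rewrite dot_mulmx mul_scalar_mx [dot (_ *: _) y]dotC dotZr -expr2 raddfB.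
  rewrite [RHS]mxE eqxx mulr1n => <-.
  rewrite mulmxA -mulmxA mxE; apply: eq_bigr => j _.
  rewrite expr2 !mxE; congr (_ * _); apply: eq_bigr => k _; rewrite !mxE//.
  by rewrite mulrC.
under eq_bigr do rewrite dX dotDr !dotZr rowee mulr1 [dot (row _ _) y]dotC.
rewrite big_split /= sumr_const card_ord; congr (_ + _).
  by rewrite mulr_natl.
by rewrite -yee mulr_sumr; apply: eq_bigr => j _; rewrite expr2 mulrA.
Qed.

Lemma jacobian_radial_form X x y (a b : R) :
  (forall v, 'd X x v = a *: v + (b * dot y v) *: y) ->
  'J X x = a%:M + b *: (y^T *m y).
Proof.
move=> dX; apply/row_matrixP => i.
rewrite !rowE /jacobian mul_rV_lin1 dX mulmxDr mul_mx_scalar -scalemxAr.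
rewrite mulmxA dot_mulmx mul_scalar_mx scalerA.
by rewrite [dot y _]dotC.
Qed.

Lemma divergenceE X x y (a b : R) :
  (forall v, 'd X x v = a *: v + (b * dot y v) *: y) ->
  divergence X x = 3 * a + b * dot y y.
Proof.
move=> dX; rewrite /divergence (jacobian_radial_form _ _ _ _ _ dX).
rewrite mxtraceD mxtrace_scalar mxtraceZ mxtrace_mulC dot_mulmx mxtrace_scalar.
by rewrite mulr1n mulr_natl.
Qed.

End EuclideanGeometry.

(** * The test field *)

Section Regularity.
Context {R : realType}.

Lemma continuous_add {T : topologicalType} (f g : T -> R) :
  continuous f -> continuous g -> continuous (fun x => f x + g x).
Proof. by move=> cf cg x; exact: (continuousD (cf x) (cg x)). Qed.

Lemma continuous_mul {T : topologicalType} (f g : T -> R) :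
  continuous f -> continuous g -> continuous (fun x => f x * g x).
Proof. by move=> cf cg x; exact: (continuousM (cf x) (cg x)). Qed.

Lemma continuous_inv {T : topologicalType} (f : T -> R) :
  (forall x, f x != 0) -> continuous f -> continuous (fun x => (f x)^-1).
Proof. by move=> f0 cf x; exact: (continuousV (f0 x) (cf x)). Qed.

Lemma continuous_mx {T : topologicalType} m n (M : T -> 'M[R]_(m, n)) :
  (forall i j, continuous (fun x => M x i j : R)) -> continuous M.
Proof.
move=> cM.
have -> : M = \sum_(i < m) \sum_(j < n)
    (fun x => M x i j *: (delta_mx i j : 'M[R]_(m, n))).
  apply/funext => x; rewrite fct_sumE {1}[M x]matrix_sum_delta.
  by apply: eq_bigr => i _; rewrite fct_sumE.
apply: (big_ind (fun f : T -> 'M[R]_(m, n) => continuous f)).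
- by move=> x; exact: cst_continuous.
- by move=> f g cf cg x; apply: continuousD; [exact: cf|exact: cg].
- move=> i _; apply: (big_ind (fun f : T -> 'M[R]_(m, n) => continuous f)).
  + by move=> x; exact: cst_continuous.
  + by move=> f g cf cg x; apply: continuousD; [exact: cf|exact: cg].
  + by move=> j _ x; apply: continuousZl; exact: cM.
Qed.

(** The mean value theorem on the segment from [y] to [x] is applied to each coordinate; for the sup
    norm this costs no dimensional factor. *)
Lemma bounded_diff_lipschitz n (X : 'rV[R]_n -> 'rV[R]_n) (K : R) :
  (forall x, differentiable X x) ->
  (forall x v, `|'d X x v| <= K * `|v|) -> lipschitz X.
Proof.
move=> dX KX.
have K0 (v : 'rV[R]_n) : 0 <= K * `|v| by exact: le_trans (normr_ge0 _) (KX 0 v).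
have mean_value x y : `|X x - X y| <= K * `|x - y|.
  apply: row_norm_le => // i; set v := x - y.
  pose g (t : R) : R := X (y + t *: v) 0 i.
  have dg (t : R) : is_derive t 1 g ('d X (y + t *: v) v 0 i).
    have dl : is_diff t (fun t : R => y + t *: v) (fun h => h *: v).
      have := is_diffD (is_diff_cst y t) (is_diff_scalel t v).
      by move=> /is_diff_eq; apply; rewrite add0r.
    have dXt : is_diff (y + t *: v) X ('d X (y + t *: v)) by exact: differentiableP.
    have dXl := is_diff_comp dl dXt.
    have dgt : is_diff t g _ := is_diff_comp dXl (is_diff_coord _ _ i).
    have dgt' : derivable g t 1 by apply/derivable1_diffP.
    apply: DeriveDef => //.
    by rewrite -derive1E derive1E'// diff_val /= scale1r.
  have [c _] := @MVT_segment R g _ 0 1 ler01 (fun t _ => dg t)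
    (derivable_within_continuous (fun t _ => @ex_derive _ _ _ _ _ _ _ (dg t))).
  rewrite /g scale0r addr0 scale1r [y + v]addrC subrK subr0 mulr1 => e.
  by rewrite !mxE e (le_trans (coord_le_norm _ _ _)).
(* [lipschitz] asks for the estimate with all sufficiently large constants. *)
exists (`|K|); split; first exact: num_real.
move=> M KM [x y] _ /=; apply: le_trans (mean_value _ _) _.
by rewrite ler_wpM2r// (le_trans (ler_norm _))// ltW.
Qed.

End Regularity.

Section TestField.
Context {R : realType} (x0 : 'rV[R]_3) (q eps : R).
Implicit Types x v : 'rV[R]_3.
Context (q0 : 0 < q) (eps0 : 0 < eps).

Definition test_field : 'rV[R]_3 -> 'rV[R]_3 := radial (profile q eps) x0.

Local Notation s x := (dot (x - x0) (x - x0)).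

Lemma is_diff_test_field x : is_diff x test_field (fun v =>
  profile q eps (s x) *: v +
  (2 * dprofile q eps (s x) * dot (x - x0) v) *: (x - x0)).
Proof. by apply: is_diff_radial; apply: is_derive_profile => //; exact: dot_ge0. Qed.

Lemma diff_test_field x v : 'd test_field x v = profile q eps (s x) *: v +
  (2 * dprofile q eps (s x) * dot (x - x0) v) *: (x - x0).
Proof. by have [_ ->] := is_diff_test_field x. Qed.

Lemma continuous_sqdist : continuous (fun x : 'rV[R]_3 => s x).
Proof.
move=> x; have [ds _] := is_diff_sqdist x0 x.
exact: differentiable_continuous.
Qed.

Lemma continuous_profile_sqdist : continuous (fun x => profile q eps (s x)).
Proof.
move=> x; apply: (@continuous_comp _ _ _ (fun x => s x) (profile q eps)).
  exact: continuous_sqdist.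
have := is_derive_profile q eps q0 eps0 _ (dot_ge0 (x - x0)).
by move=> /is_derive_is_diff[? _]; exact: differentiable_continuous.
Qed.

Lemma continuous_dprofile_sqdist : continuous (fun x => dprofile q eps (s x)).
Proof.
move=> x; apply: (@continuous_comp _ _ _ (fun x => s x) (dprofile q eps)).
  exact: continuous_sqdist.
by apply: continuous_dprofile => //; exact: dot_ge0.
Qed.

Lemma test_field_support x : test_field x != 0 -> s x < q.
Proof.
apply: contraNT; rewrite -leNgt => /(profile_out q eps q0)[sx _].
by rewrite /test_field /radial sx scale0r.
Qed.

Lemma compactly_supported_test_field : compactly_supported test_field.
Proof.
have clK : closed [set x | s x <= q].
  apply: (@closed_comp _ _ (fun x : 'rV[R]_3 => s x) [set r | r <= q]).
    by move=> x _; exact: continuous_sqdist.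
  exact: closed_le.
have sub : closure [set x | test_field x != 0] `<=` [set x | s x <= q].
  by rewrite [X in _ `<=` X](closure_id _).1//; apply: closureS => x /test_field_support /ltW.
apply: bounded_closed_compact; last exact: closed_closure.
exists (Num.sqrt q + `|x0|); split; first exact: num_real.
move=> M qM x /sub /= sx; apply: le_trans (ltW qM).
rewrite -[x](subrK x0) (le_trans (ler_normD _ _))// lerD2r.
apply: row_norm_le => [|i]; first exact: sqrtr_ge0.
by rewrite (le_trans (coord_le_enorm _ _))// ler_wsqrtr.
Qed.

Lemma C1c_test_field : C1c test_field.
Proof.
split.
- by move=> x; have [] := is_diff_test_field x.
- have -> : (fun x => 'J test_field x) = (fun x => (profile q eps (s x))%:M +
      (2 * dprofile q eps (s x)) *: ((x - x0)^T *m (x - x0))).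
    by apply/funext => x; apply: jacobian_radial_form => v; exact: diff_test_field.
  have cy (i : 'I_3) : continuous (fun x : 'rV[R]_3 => (x - x0) 0 i).
    rewrite (_ : (fun x => _) = (fun x : 'rV[R]_3 => x 0 i - x0 0 i)); last first.
      by apply/funext => x; rewrite !mxE.
    move=> x; apply: continuousB; first exact: coord_continuous.
    exact: cst_continuous.
  apply: continuous_mx => i j; rewrite (_ : (fun x => _) = (fun x =>
    profile q eps (s x) * (i == j)%:R +
    2 * dprofile q eps (s x) * ((x - x0) 0 i * (x - x0) 0 j))).
    apply: continuous_add; apply: continuous_mul.
    + exact: continuous_profile_sqdist.
    + by move=> ?; exact: cst_continuous.
    + apply: continuous_mul; first by move=> ?; exact: cst_continuous.
      exact: continuous_dprofile_sqdist.
    + by apply: continuous_mul; exact: cy.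
  apply/funext => x; rewrite !mxE big_ord1 !mxE mulr_natr.
  by congr (_ + _ * (_ * _)).
- exact: compactly_supported_test_field.
Qed.

Lemma Lipschitz_c_test_field : Lipschitz_c test_field.
Proof.
split; last exact: compactly_supported_test_field.
(* The first summand bounds [profile]. The 6 is the 2 in the differential times the 3 lost in [yv],
   where each of three products is bounded separately. *)
apply: (@bounded_diff_lipschitz _ _ _ (eps^-1 + 6 * (2 / q + eps^-1))).
  by move=> x; have [] := is_diff_test_field x.
move=> x v; rewrite diff_test_field; set y := x - x0.
have v0 : 0 <= `|v| by [].
have B0 : 0 <= 2 / q + eps^-1 by rewrite addr_ge0 ?divr_ge0 ?invr_ge0// ltW.
apply: row_norm_le => [|i].
  by rewrite mulr_ge0 ?addr_ge0 ?mulr_ge0 ?invr_ge0// ltW.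
rewrite mxE (le_trans (ler_normD _ _))// [leRHS]mulrDl lerD// mxE.
  rewrite normrM ler_pM ?coord_le_norm// ger0_norm ?profile_le ?profile_ge0//;
    exact: dot_ge0.
have yv : `|dot y v| <= 3 * enorm y * `|v|.
  rewrite /dot (le_trans (ler_norm_sum _ _ _))//.
  rewrite (@le_trans _ _ (\sum_(k < 3) enorm y * `|v|))//.
    by apply: ler_sum => k _; rewrite normrM ler_pM ?coord_le_enorm ?coord_le_norm.
  by rewrite sumr_const card_ord -[leLHS]mulr_natl mulrA.
have ys : enorm y * enorm y = s x by rewrite -expr2 sqr_enorm.
rewrite !normrM ger0_norm//.
rewrite (@le_trans _ _ (2 * `|dprofile q eps (s x)| * (3 * enorm y * `|v|) *
    enorm y))//.
  rewrite ler_pM ?mulr_ge0 ?ler_wpM2l ?mulr_ge0//.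
  by have := coord_le_enorm y i; rewrite !mxE.
rewrite [leLHS](_ : _ = 6 * (`|dprofile q eps (s x)| * s x) * `|v|).
  by rewrite ler_wpM2r// ler_wpM2l// dprofile_le ?dot_ge0.
by rewrite -ys; ring.
Qed.

End TestField.

(** * Consequences of the density bound *)

Section DensityLowerBound.
Context {R : realType}.

Lemma continuous_measurable_borel (T : ptopologicalType) (f : T -> R) :
  continuous f -> measurable_fun setT (f : borel T -> R).
Proof.
move=> cf; apply: (measurability _ (RGenOpens.measurableE R)).
move=> _ [_ [a [b ->] <-]]; rewrite setTI; apply: sub_sigma_algebra.
by apply: open_comp => [z _|]; [exact: cf|exact: interval_open].
Qed.


(** The summands with [s <= t k] telescope from the first level above [s], where the value of the
    nonincreasing [f] is at most [f s]. *)
Lemma step_minorant (f : R -> R) (t : nat -> R) n (s : R) : 0 <= s ->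
  (forall a, 0 <= a -> 0 <= f a) ->
  (forall a b, 0 <= a -> a <= b -> f b <= f a) ->
  (forall k, 0 <= t k <= t k.+1) ->
  \sum_(k < n) (f (t k) - f (t k.+1)) * (s <= t k)%R%:R <= f s.
Proof.
move=> s0 f0 fd t0.
(* The induction must retain the last value [f (t n)]; the maximum with 0 covers the case that [s]
   lies above all levels so far. *)
suff : \sum_(k < n) (f (t k) - f (t k.+1)) * (s <= t k)%R%:R <=
    Num.max 0 (f s - f (t n)).
  move=> /le_trans; apply; rewrite ge_max f0//= gerBl f0//.
  by have /andP[] := t0 n.
elim: n => [|n ih]; first by rewrite big_ord0 le_max lexx.
rewrite big_ord_recr /=; have /andP[tn0 tnS] := t0 n.
have fS := fd _ _ tn0 tnS.
have [sn|ns] := leP s (t n).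
  rewrite mulr1 le_max; apply/orP; right.
  have fsn := fd _ _ s0 sn.
  move: ih; rewrite (max_idPr _) ?subr_ge0//; lra.
rewrite mulr0 addr0 (le_trans ih)// ge_max !le_max lexx /=.
by rewrite subr_le0 (fd _ _ tn0 (ltW ns)).
Qed.

(** Each summand is a drop of eps / (s + eps)^2 between two geometric levels, times the lower level.
    For 0 < p < 1 the sum tends to p, which is close to the full integral 1 when p is close to 1. *)
Lemma geometric_layers (p : R) n :
  \sum_(k < n) p ^+ k.+1 ^+ 2 * (1 - p ^+ 2) * (p ^- k.+1 - 1) =
  p - p ^+ n.+1 * (1 + p) + p ^+ n.+1 ^+ 2.
Proof.
have [->|p0] := eqVneq p 0.
  rewrite big1 => [|k _]; first by rewrite !expr0n /=; ring.
  by rewrite !expr0n /=; ring.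
elim: n => [|n ih]; first by rewrite big_ord0; ring.
rewrite big_ord_recr /= ih !exprS; field.
by rewrite expf_neq0// p0.
Qed.

(** A step function of the squared distance integrates to a combination of measures of closed balls,
    where a lower density bound can be inserted. *)
Lemma integral_radial_layers (mu : {measure set (borel 'rV[R]_3) -> \bar R})
    (x0 : 'rV[R]_3) (f : R -> R) (c t : nat -> R) n :
  measurable_fun setT
    ((fun x => f (dot (x - x0) (x - x0))) : borel 'rV[R]_3 -> R) ->
  (forall s, 0 <= s -> 0 <= f s) ->
  (forall k, 0 <= c k) -> (forall k, 0 <= t k) ->
  (forall s, 0 <= s -> \sum_(k < n) c k * (s <= t k)%R%:R <= f s) ->
  (\sum_(k < n) (c k)%:E * mu (ecball x0 (Num.sqrt (t k))) <=
    \int[mu]_x (f (dot (x - x0) (x - x0)))%:E)%E.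
Proof.
move=> mf f0 c0 t0 cf.
have ballE k : ecball x0 (Num.sqrt (t k)) = [set x | dot (x - x0) (x - x0) <= t k].
  apply: eq_set => x; apply/propext.
  by rewrite /enorm ler_sqrt.
have mball k : measurable (ecball x0 (Num.sqrt (t k)) : set (borel 'rV[R]_3)).
  rewrite ballE -[X in measurable X]setTI.
  apply: (continuous_measurable_borel _ _ (continuous_sqdist x0) measurableT
    [set r | r <= t k]).
  by rewrite -set_itvNyc; exact: measurable_itv.
have m1 k : measurable_fun setT (\1_(ecball x0 (Num.sqrt (t k))) : borel 'rV[R]_3 -> R).
  exact: (@measurable_indic _ (borel 'rV[R]_3)) (mball k).
have mci k : measurable_fun setT (fun x : borel 'rV[R]_3 =>
    (c k)%:E * (\1_(ecball x0 (Num.sqrt (t k))) x)%:E)%E.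
  apply/measurable_EFinP; apply: measurable_funM => //.
have ci0 k x : (0 <= (c k)%:E * (\1_(ecball x0 (Num.sqrt (t k))) x)%:E)%E.
  by rewrite mule_ge0// lee_fin.
have -> : (\sum_(k < n) (c k)%:E * mu (ecball x0 (Num.sqrt (t k))) =
    \int[mu]_x \sum_(k < n) ((c k)%:E * (\1_(ecball x0 (Num.sqrt (t k))) x)%:E))%E.
  rewrite ge0_integral_sum//; apply: eq_bigr => k _.
  rewrite ge0_integralZl_EFin//; last exact/measurable_EFinP.
  by rewrite integral_indic// setIT.
apply: ge0_le_integral => //.
- by move=> x _; exact: sume_ge0.
- by apply: emeasurable_sum.
- exact/measurable_EFinP.
- move=> x _; rewrite (_ : (\sum_(k < n) _)%E =
    (\sum_(k < n) c k * (dot (x - x0) (x - x0) <= t k)%R%:R)%:E).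
    by rewrite lee_fin cf// dot_ge0.
  rewrite -sumEFin; apply: eq_bigr => k _; rewrite ballE indicE.
  by congr (_ * (_ _)%:R)%:E; rewrite mem_setE.
Qed.

(** Repeated squaring with values rounded up, using 41 = 1 + 32 + 8. *)
Lemma nine_tenths_pow : (9 / 10) ^+ 41 <= 15 / 1000 :> R.
Proof.
have sq (r b b' : R) k :
    0 <= r -> r ^+ k <= b -> b ^+ 2 <= b' -> r ^+ (k * 2) <= b'.
  by move=> r0 kb; apply: le_trans; rewrite exprM lerXn2r// nnegrE ?exprn_ge0//
    (le_trans _ kb)// exprn_ge0.
have [r r1 r0] : exists2 r : R, r = 9 / 10 & 0 <= r by exists (9 / 10) => //; lra.
rewrite -r1.
have b2 : (9 / 10) ^+ 2 <= 81 / 100 :> R by lra.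
have b4 : (81 / 100) ^+ 2 <= 657 / 1000 :> R by lra.
have b8 : (657 / 1000) ^+ 2 <= 432 / 1000 :> R by lra.
have b16 : (432 / 1000) ^+ 2 <= 187 / 1000 :> R by lra.
have b32 : (187 / 1000) ^+ 2 <= 35 / 1000 :> R by lra.
have b41 : 9 / 10 * (35 / 1000 * (432 / 1000)) <= 15 / 1000 :> R by lra.
have r8 := sq r _ _ _ r0 (sq r _ _ _ r0 (sq r _ _ 1%N r0 (_ : r ^+ 1 <= _) b2) b4) b8.
have {}r8 : r ^+ (1 * 2 * 2 * 2) <= 432 / 1000 by apply: r8; rewrite expr1 r1.
have r32 := sq _ _ _ _ r0 (sq _ _ _ _ r0 r8 b16) b32.
rewrite (_ : 41 = 1 + (1 * 2 * 2 * 2 * 2 * 2 + 1 * 2 * 2 * 2))%N//.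
rewrite exprD expr1; apply: le_trans b41.
rewrite exprD; apply: ler_pM.
- exact: r0.
- by apply: mulr_ge0; exact: exprn_ge0.
- by rewrite r1.
- by apply: ler_pM; [exact: exprn_ge0|exact: exprn_ge0|exact: r32|exact: r8].
Qed.

Lemma continuous_kernel (x0 : 'rV[R]_3) (q eps : R) : 0 < q -> 0 < eps ->
  continuous (fun x : 'rV[R]_3 => Num.max 0 (1 - dot (x - x0) (x - x0) / q) ^+ 2 *
    (eps / (dot (x - x0) (x - x0) + eps) ^+ 2)).
Proof.
move=> q0 eps0; rewrite [X in continuous X](_ : _ = fun x : 'rV[R]_3 =>
    profile q eps (dot (x - x0) (x - x0)) *
    (eps * (dot (x - x0) (x - x0) + eps)^-1)); last first.
  by apply/funext => x; rewrite /profile -mulrA mulrCA expr2 invfM; ring.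
apply: continuous_mul; first exact: continuous_profile_sqdist.
apply: continuous_mul; first by move=> ?; exact: cst_continuous.
apply: continuous_inv.
  by move=> x; rewrite gt_eqF// ltr_wpDl// dot_ge0.
apply: continuous_add; first exact: continuous_sqdist.
by move=> ?; exact: cst_continuous.
Qed.

(** In a plane through [x0] and without cut-off the integral would be exactly pi for every [eps];
    the constant 4/5 leaves room for an explicit finite layer sum. *)
Lemma density_lower_bound (mu : {measure set (borel 'rV[R]_3) -> \bar R})
    (x0 : 'rV[R]_3) (q d : R) : 0 < q -> 0 < d ->
  (forall r, 0 < r < d ->
    ((96 / 100 * pi * r ^+ 2)%:E <= mu (ecball x0 r))%E) ->
  exists2 eps, 0 < eps &
  ((4 / 5 * pi)%:E <= \int[mu]_x (Num.max 0 (1 - dot (x - x0) (x - x0) / q) ^+ 2 *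
     (eps / (dot (x - x0) (x - x0) + eps) ^+ 2))%:E)%E.
Proof.
move=> q0 d0 mud; pose p : R := 9 / 10; pose n := 40%N.
have p0 : 0 < p by rewrite /p; lra.
have p1 : p < 1 by rewrite /p; lra.
(* Below [d ^+ 2] the density hypothesis applies to the ball of radius sqrt s; below [2 / 100 * q]
   the ramp is at least 98/100. *)
pose m := Num.min (d ^+ 2) (2 / 100 * q).
have m0 : 0 < m by rewrite lt_min exprn_gt0//=; lra.
(* With this choice the highest level used, [t n.-1], equals [m - eps]. *)
pose eps := m * p ^+ n; have eps0 : 0 < eps by rewrite mulr_gt0// exprn_gt0.
exists eps => //.
(* Geometric layers s + eps = eps p^-(k+1): with p = 9/10 and 40 layers the
   layer cake recovers int_0^oo eps / (s + eps)^2 ds = 1 up to the factor 0.87. *)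
pose t k := eps * (p ^- k.+1 - 1).
pose f (s : R) := eps / (s + eps) ^+ 2.
have pk0 k : 0 < p ^+ k by rewrite exprn_gt0.
have tS k : 0 < t k <= t k.+1.
  rewrite /t; apply/andP; split.
    by rewrite mulr_gt0// subr_gt0 invf_gt1// exprn_ilt1// ltW.
  rewrite ler_wpM2l ?(ltW eps0)// lerB// lef_pV2 ?posrE// exprS.
  by rewrite ler_piMl// ltW.
have tm k : (k < n)%N -> t k < m.
  move=> kn; apply: (@le_lt_trans _ _ (eps * (p ^- n - 1))).
    rewrite ler_wpM2l ?(ltW eps0)// lerB// lef_pV2 ?posrE//.
    by rewrite ler_wiXn2l ?ltW.
  by rewrite mulrBr /eps mulfK ?gt_eqF// mulr1 gtrBl.
have f0 s : 0 <= s -> 0 <= f s.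
  by move=> s0; rewrite divr_ge0 ?sqr_ge0// ltW.
have fd a b : 0 <= a -> a <= b -> f b <= f a.
  move=> a0 ab; rewrite ler_wpM2l ?(ltW eps0)// lef_pV2 ?posrE.
  - by rewrite lerXn2r ?nnegrE ?addr_ge0 ?lerD2r ?(ltW eps0)// (le_trans a0).
  - by rewrite exprn_gt0// ltr_wpDl// (le_trans a0).
  - by rewrite exprn_gt0// ltr_wpDl.
pose c k := (98 / 100) ^+ 2 * (f (t k) - f (t k.+1)).
have c0 k : 0 <= c k.
  have /andP[tk0 tkS] := tS k.
  by rewrite mulr_ge0 ?sqr_ge0// subr_ge0 fd// ltW.
have cf s : 0 <= s -> \sum_(k < n) c k * (s <= t k)%R%:R <=
    Num.max 0 (1 - s / q) ^+ 2 * f s.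
  (* Beyond [m] no layer is active, so the sum vanishes. *)
  move=> s0; have [sm|ms] := leP s m; last first.
    rewrite big1 => [|k _]; first by rewrite mulr_ge0 ?sqr_ge0 ?f0.
    by rewrite leNgt (lt_trans (tm _ (ltn_ord k)) ms) mulr0.
  apply: (@le_trans _ _ ((98 / 100) ^+ 2 * f s)).
    under eq_bigr do rewrite -mulrA.
    rewrite -mulr_sumr ler_wpM2l ?sqr_ge0// step_minorant// => k.
    by have /andP[/ltW -> ->] := tS k.
  have sq : s / q <= 2 / 100.
    by rewrite ler_pdivrMr// (le_trans sm)// /m ge_min lexx orbT.
  have ? : 98 / 100 <= Num.max 0 (1 - s / q).
    by rewrite le_max; apply/orP; right; lra.
  by rewrite ler_wpM2r ?f0// lerXn2r// nnegrE ?le_max ?lexx//; lra.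
apply: le_trans (integral_radial_layers mu x0
  (fun s => Num.max 0 (1 - s / q) ^+ 2 * f s) c t n _ _ c0 _ cf); last 3 first.
- exact: continuous_measurable_borel _ _ (continuous_kernel x0 _ _ q0 eps0).
- by move=> s s0; rewrite mulr_ge0 ?sqr_ge0 ?f0.
- by move=> k; have /andP[/ltW] := tS k.
(* The scale [eps] cancels from every layer, which leaves the sum of [geometric_layers]. *)
have ctE k : (98 / 100) ^+ 2 * (96 / 100) * pi *
    (p ^+ k.+1 ^+ 2 * (1 - p ^+ 2) * (p ^- k.+1 - 1)) =
    c k * (96 / 100 * pi * t k).
  rewrite /c /f /t !mulrBr !mulr1 !subrK !exprS.
  by field; rewrite /= !gt_eqF.
apply: (@le_trans _ _ (\sum_(k < n) (c k * (96 / 100 * pi * t k))%:E)%E); last first.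
  apply: lee_sum => k _; rewrite EFinM lee_wpmul2l ?lee_fin ?c0//.
  have /andP[tk0 _] := tS k.
  have := mud (Num.sqrt (t k)); rewrite sqr_sqrtr ?(ltW tk0)//; apply.
  rewrite sqrtr_gt0 tk0/= -[ltRHS](gtr0_norm d0) -sqrtr_sqr ltr_sqrt ?exprn_gt0//.
  by rewrite (lt_le_trans (tm _ (ltn_ord k)))// ge_min lexx.
rewrite sumEFin lee_fin; under eq_bigr do rewrite -ctE.
rewrite -mulr_sumr geometric_layers.
have pn : p ^+ n.+1 <= 15 / 1000.
  exact: nine_tenths_pow.
(* The three losses, from the cut-off, the density and the finite layer sum, multiply to slightly
   more than 4/5. *)
have : 4 / 5 <= (98 / 100) ^+ 2 * (96 / 100) *
    (p - p ^+ n.+1 * (1 + p) + p ^+ n.+1 ^+ 2).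
  have := sqr_ge0 (p ^+ n.+1); move: pn; set r := p ^+ n.+1.
  by rewrite /p => *; nra.
by move=> /(ler_wpM2r (pi_ge0 R)) /le_trans; apply; rewrite mulrAC.
Qed.

End DensityLowerBound.

(** * Monotonicity inequality *)

Section Measurability.
Context {R : realType}.

Lemma measurable_dot d (T : measurableType d) (a b : T -> 'rV[R]_3) :
  (forall i, measurable_fun setT (fun t => a t 0 i : R)) ->
  (forall i, measurable_fun setT (fun t => b t 0 i : R)) ->
  measurable_fun setT (fun t => dot (a t) (b t)).
Proof.
move=> ma mb; rewrite /dot.
by apply: measurable_sum => i; apply: measurable_funM.
Qed.

Lemma measurable_coord_borel d (T : measurableType d) (H : T -> borel 'rV[R]_3) i :
  measurable_fun setT H -> measurable_fun setT (fun t => H t 0 i : R).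
Proof.
move=> mH.
have := continuous_measurable_borel _ _ (@coord_continuous R 1 3 0 i).
by move=> /measurableT_comp; apply.
Qed.

Lemma continuous_base_coord i : continuous (fun z : G2o R => z.1 0 i : R).
Proof.
move=> z; apply: (@continuous_comp _ _ _ fst (fun x : 'rV[R]_3 => x 0 i : R)).
  exact: cvg_fst.
exact: coord_continuous.
Qed.

Lemma continuous_star_coord i :
  continuous (fun z : G2o R => star (sval z.2) 0 i : R).
Proof.
have -> : (fun z : G2o R => star (sval z.2) 0 i : R) =
    (fun M : 'M[R]_3 => M (i + 1) (i + 2%:R) : R) \o
    ((fun xi : Go R => sval xi) \o snd).
  by apply/funext => z; rewrite /= mxE.
move=> z; apply: continuous_comp; last exact: coord_continuous.
apply: continuous_comp; first exact: cvg_snd.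
exact: initial_continuous.
Qed.

(** For a unit vector [n], a vanishing wedge means that [a] is its own normal part <n, a> n. *)
Lemma dot_normal (a n y : 'rV[R]_3) :
  wedge a n = 0 -> dot n n = 1 -> dot y a = dot y n * dot n a.
Proof.
move=> /eqP; rewrite subr_eq0 => /eqP an nn.
have : dot y a *: n = dot y n *: a.
  by rewrite -!mul_scalar_mx -!dot_mulmx -!mulmxA an.
by move=> /(congr1 (dot n)); rewrite !dotZr nn mulr1.
Qed.

Lemma wedge_self (n : 'rV[R]_3) : wedge n n = 0.
Proof. exact: subrr. Qed.

Lemma wedgeBl (a b n : 'rV[R]_3) : wedge (a - b) n = wedge a n - wedge b n.
Proof.
rewrite /wedge [(a - b)^T]raddfB /= mulmxBl mulmxBr.
by rewrite !opprB !addrA addrAC [in RHS]addrAC; congr (_ + _); rewrite addrAC.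
Qed.

Lemma wedgeZl (c : R) (a n : 'rV[R]_3) : wedge (c *: a) n = c *: wedge a n.
Proof. by rewrite /wedge linearZ /= -scalemxAl -scalemxAr scalerBr. Qed.

End Measurability.

Lemma ae_eq_integrable d (T : measurableType d) (R : realType)
    (mu : {measure set T -> \bar R}) (f g : T -> \bar R) :
  measurable_fun setT f -> mu.-integrable setT g -> ae_eq mu setT f g ->
  mu.-integrable setT f.
Proof.
move=> mf /integrableP[mg gfin] fg; apply/integrableP; split => //.
rewrite (@ge0_ae_eq_integral _ _ _ _ _ _ (abse \o g))//.
- exact: measurableT_comp.
- exact: measurableT_comp.
- by move=> x _ /=.
- by apply: filterS fg => x fgx Dx /=; rewrite fgx.
Qed.

(** * First variation, flux and enclosed volume *)

Section FirstVariationIdentity.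
Context {R : realType} (V : {measure set (borel (G2o R)) -> \bar R})
  (H : 'rV[R]_3 -> 'rV[R]_3) (E : set (lebesgue3_type R))
  (Theta : lebesgue3_type R -> nat) (c0 : R).
Context (hV : varifold_with_enclosed_volume V H E Theta).
Context (hmass : (weight V setT < +oo)%E).
Context (hhelfrich : (helfrich V H c0 < +oo)%E).
Context (x0 : 'rV[R]_3) (q eps : R).
Context (q0 : 0 < q) (eps0 : 0 < eps).
Implicit Types z : G2o R.

Local Notation X := (test_field x0 q eps).
Local Notation nu z := (star (sval z.2)).
Local Notation h z := (H z.1 - c0 *: star (sval z.2)).
Local Notation y z := (z.1 - x0).
Local Notation s z := (dot (z.1 - x0) (z.1 - x0)).
Local Notation phi z := (profile q eps (dot (z.1 - x0) (z.1 - x0))).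
Local Notation dphi z := (dprofile q eps (dot (z.1 - x0) (z.1 - x0))).
Local Notation tdiv z := (tangential_divergence (tangent_plane z.2) X z.1).

Lemma energy_lty : (\int[V]_z (enorm (h z) ^+ 2)%:E < +oo)%E.
Proof.
move: hhelfrich; rewrite /helfrich; set I := (\int[V]_z _)%E.
have : (0 <= I)%E by apply: integral_ge0 => z _; rewrite lee_fin sqr_ge0.
by case: I => [r| |]//= _; rewrite ?ltry// gt0_muley ?lte_fin.
Qed.

Let mnu i : measurable_fun setT (fun z : borel (G2o R) => nu z 0 i : R).
Proof. exact: continuous_measurable_borel _ _ (continuous_star_coord i). Qed.

Let mH i : measurable_fun setT (fun z : borel (G2o R) => H z.1 0 i : R).
Proof.
apply: (@measurable_coord_borel _ _ (borel (G2o R)) (H \o fst : _ -> borel 'rV[R]_3) i).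
exact: measurableT_comp (evol_measurable_H hV) (@measurable_fst_borel R).
Qed.

Let mh i : measurable_fun setT (fun z : borel (G2o R) => h z 0 i : R).
Proof.
under eq_fun do rewrite !mxE.
apply: measurable_funB; first exact: mH.
apply: measurable_funM => //.
have := mnu i; under [in X in X -> _]eq_fun do rewrite mxE.
exact.
Qed.

Let my i : measurable_fun setT (fun z : borel (G2o R) => y z 0 i : R).
Proof.
under eq_fun do rewrite !mxE.
apply: measurable_funB => //.
exact: continuous_measurable_borel _ _ (continuous_base_coord i).
Qed.

Lemma measurable_energy :
  measurable_fun setT (fun z : borel (G2o R) => enorm (h z) ^+ 2).
Proof. by under eq_fun do rewrite sqr_enorm; exact: measurable_dot. Qed.

Lemma integrable_energy : V.-integrable setT (fun z => (enorm (h z) ^+ 2)%:E).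
Proof.
apply/integrableP; split; first by apply/measurable_EFinP; exact: measurable_energy.
apply: le_lt_trans energy_lty; apply: ge0_le_integral => //.
- by apply/measurable_EFinP; apply: measurableT_comp => //; exact: measurable_energy.
- by apply/measurable_EFinP; exact: measurable_energy.
- by move=> z _; rewrite lee_fin ger0_norm// sqr_ge0.
Qed.


Let integrable_bounded (f : G2o R -> R) (M : R) :
  measurable_fun setT (f : borel (G2o R) -> R) -> (forall z, `|f z| <= M) ->
  V.-integrable setT (EFin \o f).
Proof.
move=> mf fM; apply: measurable_bounded_integrable => //.
exists M; split; first exact: num_real.
by move=> M' MM' z _ /=; exact: le_trans (fM z) (ltW MM').
Qed.

Let mphi : measurable_fun setT (fun z : borel (G2o R) => phi z).
Proof.
apply: (@continuous_measurable_borel _ (G2o R)) => z.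
apply: (@continuous_comp _ _ _ fst (fun x : 'rV[R]_3 => profile q eps (dot (x - x0) (x - x0)))).
  exact: cvg_fst.
exact: continuous_profile_sqdist.
Qed.

Let mdphi : measurable_fun setT (fun z : borel (G2o R) => dphi z).
Proof.
apply: (@continuous_measurable_borel _ (G2o R)) => z.
apply: (@continuous_comp _ _ _ fst (fun x : 'rV[R]_3 => dprofile q eps (dot (x - x0) (x - x0)))).
  exact: cvg_fst.
exact: continuous_dprofile_sqdist.
Qed.

Let mynu : measurable_fun setT (fun z : borel (G2o R) => dot (y z) (nu z)).
Proof. exact: measurable_dot. Qed.

Lemma tangential_divergence_test_field z :
  tdiv z = 2 * phi z + 2 * dphi z * (s z - dot (y z) (nu z) ^+ 2).
Proof. by apply: tangential_divergenceE => v; exact: diff_test_field. Qed.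

Let ynu_le z : dot (y z) (nu z) ^+ 2 <= s z.
Proof. by rewrite (le_trans (Cauchy_Schwarz _ _))// star_unit mulr1. Qed.

Let phi_ge0 z : 0 <= phi z.
Proof. by apply: profile_ge0 => //; exact: dot_ge0. Qed.

Let phi_le z : phi z <= eps^-1.
Proof. by apply: profile_le => //; exact: dot_ge0. Qed.

Lemma integrable_tangential_divergence : V.-integrable setT (fun z => (tdiv z)%:E).
Proof.
apply: (@integrable_bounded (fun z => tdiv z) (2 * eps^-1 + 2 * (2 / q + eps^-1))).
  under eq_fun do rewrite tangential_divergence_test_field.
  apply: measurable_funD; first exact: measurable_funM.
  apply: measurable_funM; first exact: measurable_funM.
  apply: measurable_funB; first exact: measurable_dot.
  exact: measurable_funX.
move=> z; rewrite tangential_divergence_test_field (le_trans (ler_normD _ _))// lerD//.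
  by rewrite normrM !ger0_norm// ler_wpM2l.
rewrite -mulrA normrM ger0_norm// ler_wpM2l//.
apply: le_trans (dprofile_le q eps q0 eps0 _ (dot_ge0 (y z))).
rewrite normrM ler_wpM2l// ger0_norm ?subr_ge0//.
by rewrite gerBl sqr_ge0.
Qed.

Local Notation k z := (profile q eps (dot (z.1 - x0) (z.1 - x0)) *
  dot (z.1 - x0) (star (sval z.2))).

Let mk : measurable_fun setT ((fun z => k z) : borel (G2o R) -> R).
Proof. exact: measurable_funM. Qed.

(** Off the ball [profile] vanishes; inside, <y, nu>^2 is at most s < q. *)
Let k_le z : k z ^+ 2 <= eps^-1 ^+ 2 * q.
Proof.
have [zq|qz] := ltP (s z) q; last first.
  have [k0 _] := profile_out q eps q0 _ qz.
  by rewrite k0 mul0r expr2 mul0r mulr_ge0 ?sqr_ge0// ltW.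
rewrite exprMn ler_pM ?sqr_ge0//.
  by rewrite lerXn2r ?nnegrE ?invr_ge0 ?(ltW eps0).
by rewrite (le_trans (ynu_le z))// ltW.
Qed.

Lemma integrable_flux : V.-integrable setT (fun z => (k z)%:E).
Proof.
apply: (@integrable_bounded (fun z => k z) (1 + eps^-1 ^+ 2 * q)) => // z.
have := k_le z; rewrite ler_norml => ?; have := sqr_ge0 (k z - 1).
have := sqr_ge0 (k z + 1).
by move=> *; apply/andP; split; nra.
Qed.

Let mk2 : measurable_fun setT
  ((fun z => k z * dot (nu z) (h z)) : borel (G2o R) -> R).
Proof. by apply: measurable_funM => //; exact: measurable_dot. Qed.

(* Since H is normal, <x - x0, h> = <x - x0, nu> <nu, h> for V-almost every point;
   the right-hand side keeps the pointwise estimates below valid everywhere. *)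
Lemma integrable_curvature_term :
  V.-integrable setT (fun z => (k z * dot (nu z) (h z))%:E).
Proof.
apply: (@le_integrable _ (borel (G2o R)) R V _ measurableT _
  (fun z : borel (G2o R) => (eps^-1 ^+ 2 * q)%:E + (enorm (h z) ^+ 2)%:E)%E).
- exact/measurable_EFinP.
- move=> z _; rewrite !abse_EFin lee_fin [leRHS]ger0_norm; last first.
    by rewrite addr_ge0 ?sqr_ge0// mulr_ge0 ?sqr_ge0// ltW.
  have := k_le z; have := Cauchy_Schwarz (nu z) (h z).
  rewrite star_unit mul1r -sqr_enorm ler_norml.
  set a := k z; set b := dot _ _; set c := enorm _ ^+ 2; set d := _ * q.
  have := sqr_ge0 (a - b); have := sqr_ge0 (a + b).
  by move=> *; apply/andP; split; nra.
- apply: integrableD => //; last exact: integrable_energy.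
  by apply: (@integrable_bounded (fun=> eps^-1 ^+ 2 * q) `|eps^-1 ^+ 2 * q|).
Qed.

(** As H = h + c0 nu is normal almost everywhere, <X, H> splits into the curvature term and c0 times
    the flux of X. The first variation handles the former, and the divergence identity turns the
    flux into a volume integral. *)
Lemma first_variation_identity :
  (\int[V]_z (tdiv z + k z * dot (nu z) (h z))%:E =
   c0%:E * \int[@lebesgue3 R]_(x in E) (divergence X x * (Theta x)%:R)%:E)%E.
Proof.
rewrite -(evol_divergence hV (Lipschitz_c_test_field _ _ _ q0 eps0)).
have -> : (\int[V]_z (dot (X z.1) (nu z))%:E = \int[V]_z (k z)%:E)%E.
  by apply: eq_integral => z _; rewrite dotC dotZr dotC.
have XH : (\int[weight V]_x (dot (X x) (H x))%:E =
    \int[V]_z (k z * dot (nu z) (h z))%:E + c0%:E * \int[V]_z (k z)%:E)%E.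
  have mXH : measurable_fun setT
      ((fun x => (dot (X x) (H x))%:E) : borel 'rV[R]_3 -> \bar R).
    apply/measurable_EFinP; apply: measurable_dot => i.
      rewrite [X in measurable_fun _ X](_ : _ = (fun x : 'rV[R]_3 =>
          profile q eps (dot (x - x0) (x - x0)) * (x 0 i - x0 0 i))); last first.
        by apply/funext => x; rewrite !mxE.
      apply: measurable_funM.
        apply: (@continuous_measurable_borel _ 'rV[R]_3).
        exact: continuous_profile_sqdist.
      apply: measurable_funB => //.
      exact: continuous_measurable_borel _ _ (@coord_continuous R 1 3 0 i).
    exact: (@measurable_coord_borel _ _ (borel 'rV[R]_3) _ i (evol_measurable_H hV)).
  have mXHV := measurableT_comp mXH (@measurable_fst_borel R).
  have aeXH : ae_eq V setT ((fun x => (dot (X x) (H x))%:E) \o fst)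
      (fun z => (k z * dot (nu z) (h z))%:E + c0%:E * (k z)%:E)%E.
    apply: (@filterS _ _ (ae_filter_ringOfSetsType V) _ _ _ (evol_normal hV)).
    move=> z Hz _ /=.
    rewrite -EFinM -EFinD; congr _%:E.
    have -> : dot (X z.1) (H z.1) = phi z * dot (y z) (H z.1).
      by rewrite dotC dotZr dotC.
    have -> : dot (y z) (H z.1) = dot (y z) (h z) + c0 * dot (y z) (nu z).
      by rewrite -dotZr -dotDr subrK.
    have hz : wedge (h z) (nu z) = 0.
      by rewrite wedgeBl wedgeZl wedge_self Hz scaler0 subr0.
    by rewrite (dot_normal _ _ _ hz (star_unit _)); ring.
  have int_sum : V.-integrable setT
      (fun z => (k z * dot (nu z) (h z))%:E + c0%:E * (k z)%:E)%E.
    apply: integrableD => //; first exact: integrable_curvature_term.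
    by apply: integrableZl => //; exact: integrable_flux.
  (* Changing variables for a signed integrand needs integrability upstairs, inherited from the
     almost everywhere equal sum. *)
  rewrite (integral_pushforward (@measurable_fst_borel R) mXH)//; last first.
    exact: ae_eq_integrable int_sum aeXH.
  rewrite preimage_setT (ae_eq_integral _ _ _ _ _ aeXH)//; last first.
    exact: measurable_int int_sum.
  rewrite integralD//; first last.
  - by apply: integrableZl => //; exact: integrable_flux.
  - exact: integrable_curvature_term.
  by rewrite integralZl//; exact: integrable_flux.
have := evol_first_variation hV (C1c_test_field x0 _ _ q0 eps0).
rewrite /first_variation XH => fv.
under eq_integral do rewrite EFinD.
rewrite integralD//; [|exact: integrable_tangential_divergence|exact: integrable_curvature_term].
rewrite [X in (X + _)%E]fv.
(* Finiteness allows the cancellation to be carried out in the reals. *)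
have := integrable_fin_num measurableT integrable_flux.
have := integrable_fin_num measurableT integrable_curvature_term.
set a := integral _ _ _; set b := integral _ _ _ => af bf.
rewrite -(fineK af) -(fineK bf) -!EFinM -!EFinD; congr _%:E.
by ring.
Qed.

End FirstVariationIdentity.

Section LebesgueMeasurability.
Context {R : realType}.

Lemma borel_lebesgue3_measurable (A : set (borel 'rV[R]_3)) :
  measurable A -> measurable (A : set (lebesgue3_type R)).
Proof. exact: caratheodory_measurable_mu_ext. Qed.

Lemma continuous_measurable_lebesgue3 (f : 'rV[R]_3 -> R) :
  continuous f -> measurable_fun setT (f : lebesgue3_type R -> R).
Proof.
move=> cf _ Y mY; apply: borel_lebesgue3_measurable.
exact: continuous_measurable_borel cf measurableT _ mY.
Qed.

Lemma open_sqdist_lt (x0 : 'rV[R]_3) (q : R) :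
  open [set x | dot (x - x0) (x - x0) < q].
Proof.
apply: (@open_comp _ _ (fun x : 'rV[R]_3 => dot (x - x0) (x - x0)) [set r | r < q]).
  by move=> x _; exact: continuous_sqdist.
exact: open_lt.
Qed.

Lemma measurable_sqdist_lt (x0 : 'rV[R]_3) (q : R) :
  measurable ([set x | dot (x - x0) (x - x0) < q] : set (borel 'rV[R]_3)).
Proof. by apply: sub_sigma_algebra; exact: open_sqdist_lt. Qed.

End LebesgueMeasurability.

(** * The local inequality on a ball *)

Section MonotonicityInequality.
Context {R : realType} (V : {measure set (borel (G2o R)) -> \bar R})
  (H : 'rV[R]_3 -> 'rV[R]_3) (E : set (lebesgue3_type R))
  (Theta : lebesgue3_type R -> nat) (c0 : R).
Context (hV : varifold_with_enclosed_volume V H E Theta).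
Context (hmass : (weight V setT < +oo)%E).
Context (hhelfrich : (helfrich V H c0 < +oo)%E).
Context (hTheta : (@lebesgue3 R).-integrable E (fun x => (Theta x)%:R%:E)) (hc0 : c0 <= 0).
Context (x0 : 'rV[R]_3) (q eps : R).
Context (q0 : 0 < q) (eps0 : 0 < eps).
Implicit Types z : G2o R.

Local Notation X := (test_field x0 q eps).
Local Notation nu z := (star (sval z.2)).
Local Notation h z := (H z.1 - c0 *: star (sval z.2)).
Local Notation y z := (z.1 - x0).
Local Notation s z := (dot (z.1 - x0) (z.1 - x0)).
Local Notation phi z := (profile q eps (dot (z.1 - x0) (z.1 - x0))).
Local Notation dphi z := (dprofile q eps (dot (z.1 - x0) (z.1 - x0))).
Local Notation tdiv z := (tangential_divergence (tangent_plane z.2) X z.1).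


Local Notation B := [set x : 'rV[R]_3 | dot (x - x0) (x - x0) < q].
Local Notation G z := (Num.max 0 (1 - dot (z - x0) (z - x0) / q) ^+ 2 *
  (eps / (dot (z - x0) (z - x0) + eps) ^+ 2)).

Lemma divergence_test_fieldE x : divergence X x =
  3 * profile q eps (dot (x - x0) (x - x0)) +
  2 * dprofile q eps (dot (x - x0) (x - x0)) * dot (x - x0) (x - x0).
Proof. by apply: divergenceE => v; exact: diff_test_field. Qed.

Lemma continuous_divergence : continuous (divergence X).
Proof.
rewrite (_ : divergence X = fun x =>
  3 * profile q eps (dot (x - x0) (x - x0)) +
  2 * dprofile q eps (dot (x - x0) (x - x0)) * dot (x - x0) (x - x0)); last first.
  by apply/funext => x; exact: divergence_test_fieldE.
apply: continuous_add; apply: continuous_mul.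
- by move=> ?; exact: cst_continuous.
- exact: continuous_profile_sqdist.
- apply: continuous_mul; first by move=> ?; exact: cst_continuous.
  exact: continuous_dprofile_sqdist.
- exact: continuous_sqdist.
Qed.

Lemma integrable_divergence_Theta :
  (@lebesgue3 R).-integrable E (fun x => (divergence X x * (Theta x)%:R)%:E).
Proof.
have mE := evol_measurable_E hV.
have mT : measurable_fun E (fun x => (Theta x)%:R : R).
  by have /measurable_int/measurable_EFinP := hTheta.
pose M := 3 * eps^-1 + 2 * (2 / q + eps^-1).
have M0 : 0 <= M by rewrite addr_ge0 ?mulr_ge0 ?addr_ge0 ?divr_ge0 ?invr_ge0 ?ltW.
apply: (@le_integrable _ _ _ _ _ mE _ (fun x => M%:E * (Theta x)%:R%:E)%E).
- apply/measurable_EFinP; apply: measurable_funM => //.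
  exact/measurable_funTS/continuous_measurable_lebesgue3/continuous_divergence.
- move=> x _; rewrite -EFinM !abse_EFin lee_fin !normrM ler_wpM2r//.
  rewrite (ger0_norm M0) divergence_test_fieldE (le_trans (ler_normD _ _))//.
  have s0 := dot_ge0 (x - x0); rewrite lerD//.
    by rewrite normrM !ger0_norm ?profile_ge0// ler_wpM2l// profile_le.
  rewrite -mulrA normrM ger0_norm// ler_wpM2l//.
  by rewrite normrM (ger0_norm s0) dprofile_le.
- exact: integrableZl.
Qed.

Lemma divergence_ge x : - (4 / q * (x \in B)%:R) <= divergence X x.
Proof.
rewrite divergence_test_fieldE.
have -> : (x \in B) = (dot (x - x0) (x - x0) < q) by apply/idP/idP; rewrite in_setE.
have [xq|qx] := ltP (dot (x - x0) (x - x0)) q.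
  by rewrite mulr1 space_divergence_ge// dot_ge0.
by have [-> ->] := profile_out q eps q0 _ qx; rewrite !(mulr0, mul0r) oppr0 addr0.
Qed.

(** Multiplication by [c0 <= 0] turns the lower bound on the divergence into an upper bound with
    [|c0|], supported in the ball. *)
Lemma volume_term_le :
  (c0%:E * \int[@lebesgue3 R]_(x in E) (divergence X x * (Theta x)%:R)%:E <=
   (4 / q * `|c0|)%:E * \int[@lebesgue3 R]_(x in E `&` B) (Theta x)%:R%:E)%E.
Proof.
have mE := evol_measurable_E hV.
have mB : measurable (B : set (lebesgue3_type R)).
  exact: borel_lebesgue3_measurable (measurable_sqdist_lt x0 q).
have iB : (@lebesgue3 R).-integrable E ((fun x => (Theta x)%:R%:E) \_ B).
  apply: le_integrable hTheta => //.
    have mT := measurable_funS mE (@subIsetl _ E B) (measurable_int _ hTheta).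
    exact: (measurable_restrict _ mB mE).1 mT.
  by move=> x _; rewrite patchE; case: ifP => // _; rewrite abse0.
rewrite integral_mkcondr -!integralZl//; last exact: integrable_divergence_Theta.
apply: le_integral => //.
- exact/integrableZl/integrable_divergence_Theta.
- exact: integrableZl.
move=> x _; rewrite patchE.
have -> : (if x \in B then (Theta x)%:R%:E else 0%E) =
  ((x \in B)%:R * (Theta x)%:R)%:E :> \bar R.
  by case: ifP => _; rewrite ?mul1r ?mul0r.
rewrite -!EFinM lee_fin !mulrA ler_wpM2r// ler0_norm//.
have := divergence_ge x; set b := (_ \in _)%:R; set d := divergence _ _ => db.
by have := ler_wnM2l hc0 db; rewrite !mulrN mulNr [c0 * (_ * b)]mulrCA mulrA.
Qed.

(** The normal component of the field contributes - 2 phi' <y, nu>^2, which is at least 2 phi^2 <y,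
    nu>^2 and absorbs the curvature term at the price of |h|^2 / 8. Outside the ball both sides
    vanish. *)
Lemma integrand_ge z :
  2 * G z.1 <= tdiv z + phi z * dot (y z) (nu z) * dot (nu z) (h z) +
    (4 / q * (z.1 \in B)%:R + 8^-1 * (enorm (h z) ^+ 2 * (z.1 \in B)%:R)).
Proof.
have s0 := dot_ge0 (y z).
have -> : (z.1 \in B) = (s z < q) by apply/idP/idP; rewrite in_setE.
rewrite tangential_divergence_test_field//; have [sq|qs] := ltP (s z) q; last first.
  have [-> ->] := profile_out q eps q0 _ qs.
  have -> : Num.max 0 (1 - s z / q) = 0.
    by apply/max_idPl; rewrite subr_le0 ler_pdivlMr// mul1r.
  by rewrite expr2 !(mulr0, mul0r, addr0).
have := planar_divergence_ge q eps q0 eps0 _ s0 sq.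
have := sqr_profile_le q eps q0 eps0 _ s0.
have := Cauchy_Schwarz (nu z) (h z).
rewrite star_unit mul1r -sqr_enorm !mulr1.
set f := phi z; set f' := dphi z; set c := dot _ (h z); set n := dot _ (nu z).
set d := enorm _ ^+ 2 => cd ff' le.
suff : 0 <= - (2 * f' * n ^+ 2) + f * n * c + 8^-1 * d by lra.
have n0 : 0 <= n ^+ 2 by exact: sqr_ge0.
have := ler_wpM2r n0 ff'.
(* Twice this square is 2 f^2 n^2 + f n c + c^2 / 8, where f^2 <= - f' and c^2 <= d. *)
have := sqr_ge0 (f * n + c / 4).
have -> : (f * n + c / 4) ^+ 2 = f ^+ 2 * n ^+ 2 + f * n * c / 2 + c ^+ 2 / 16.
  by field.
rewrite mulNr -mulrA; lra.
Qed.

(** This is [integrand_ge] integrated against [V]; the first variation identity replaces the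
    divergence and curvature terms by the volume term, bounded in [volume_term_le]. *)
Lemma monotonicity_inequality :
  (2%:E * \int[weight V]_x (G x)%:E <=
    (4 / q)%:E * weight V B +
    (8^-1)%:E * \int[V]_(z in fst @^-1` B) (enorm (h z) ^+ 2)%:E +
    (4 / q * `|c0|)%:E * \int[@lebesgue3 R]_(x in E `&` B) (Theta x)%:R%:E)%E.
Proof.
have mB := measurable_sqdist_lt x0 q.
have mfB : measurable (fst @^-1` B : set (borel (G2o R))).
  by rewrite -[X in measurable X]setTI; exact: (@measurable_fst_borel R).
have G0 x : 0 <= G x.
  by rewrite mulr_ge0 ?sqr_ge0// divr_ge0 ?sqr_ge0// ltW.
have mG := continuous_measurable_borel _ _ (continuous_kernel x0 q eps q0 eps0).
have mGV := measurableT_comp mG (@measurable_fst_borel R).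
have mE2 := measurable_energy V H E Theta c0 hV.
(* The error terms on the ball, written with indicators so that all integrals run over the whole
   space. *)
pose P (z : borel (G2o R)) : \bar R := ((4 / q)%:E * (\1_(fst @^-1` B) z)%:E +
  (8^-1)%:E * ((fun z => (enorm (h z) ^+ 2)%:E) \_ (fst @^-1` B)) z)%E.
have q4 : 0 <= 4 / q by rewrite divr_ge0// ltW.
have P1 z : (0 <= (4 / q)%:E * (\1_(fst @^-1` B) z)%:E)%E.
  by rewrite mule_ge0// lee_fin.
have P2' z : (0 <= ((fun z => (enorm (h z) ^+ 2)%:E) \_ (fst @^-1` B)) z)%E.
  by rewrite patchE; case: ifP => // _; rewrite lee_fin sqr_ge0.
have P2 z : (0 <= (8^-1)%:E *
    ((fun z => (enorm (h z) ^+ 2)%:E) \_ (fst @^-1` B)) z)%E.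
  by rewrite mule_ge0// lee_fin.
have m1B : measurable_fun setT (fun z : borel (G2o R) => (\1_(fst @^-1` B) z)%:E : \bar R).
  by apply/measurable_EFinP; exact: measurable_indic.
have ih : V.-integrable setT ((fun z => (enorm (h z) ^+ 2)%:E) \_ (fst @^-1` B)).
  apply/(integrable_mkcond _ mfB).1.
  apply: integrableS (integrable_energy V H E Theta c0 hV hhelfrich) => //.
have i1 : V.-integrable setT (fun z : borel (G2o R) => (\1_(fst @^-1` B) z)%:E).
  apply: (@measurable_bounded_integrable _ _ _ V (\1_(fst @^-1` B))) => //.
  exists 1; split => // M M1 z _ /=; apply: le_trans (ltW M1).
  by rewrite indicE; case: (_ \in _); rewrite ?normr1 ?normr0.
have iP : V.-integrable setT P.
  by apply: integrableD => //; exact: integrableZl.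
have -> : ((4 / q)%:E * weight V B +
    (8^-1)%:E * \int[V]_(z in fst @^-1` B) (enorm (h z) ^+ 2)%:E =
    \int[V]_z P z)%E.
  rewrite ge0_integralD//; first last.
  - exact: measurable_int (integrableZl measurableT _ ih).
  - exact: measurable_int (integrableZl measurableT _ i1).
  rewrite !integralZl// integral_indic// setIT; congr (_ + _ * _)%E.
  by rewrite [LHS]integral_mkcond.
have iL := integrable_tangential_divergence V hmass x0 q eps q0 eps0.
have iC := integrable_curvature_term V H E Theta c0 hV hmass hhelfrich x0 q eps q0 eps0.
have iLC : V.-integrable setT
    (fun z => (tdiv z + phi z * dot (y z) (nu z) * dot (nu z) (h z))%:E).
  under eq_fun do rewrite EFinD.
  exact: integrableD.
apply: (@le_trans _ _ (\int[V]_z P z +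
  \int[V]_z (tdiv z + phi z * dot (y z) (nu z) * dot (nu z) (h z))%:E)%E); last first.
  rewrite leeD2l//
    (first_variation_identity V H E Theta c0 hV hmass hhelfrich x0 q eps q0 eps0).
  exact: volume_term_le.
rewrite -integralD//.
rewrite (ge0_integral_pushforward (@measurable_fst_borel R))//; last 2 first.
- exact/measurable_EFinP.
- by move=> x _; rewrite lee_fin.
rewrite preimage_setT -ge0_integralZl_EFin//; last 2 first.
- by move=> z _; rewrite lee_fin.
- exact/measurable_EFinP.
apply: ge0_le_integral => //.
- by move=> z _; rewrite -EFinM lee_fin mulr_ge0.
- by apply/measurable_EFinP; apply: measurable_funM.
- exact: measurable_int (integrableD measurableT iP iLC).
- move=> z _; have := integrand_ge z; rewrite /P patchE indicE.
  have -> : (z \in fst @^-1` B) = (z.1 \in B).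
    by apply/idP/idP; rewrite !in_setE.
  by case: (_ \in B); rewrite ?(mulr0, mulr1, mule0, mule1) => GP;
    rewrite -!EFinM -!EFinD lee_fin (le_trans GP)// [leLHS]addrC.
Qed.

End MonotonicityInequality.

(** * Covering by disjoint balls *)

(** The sum is the integral over a disjoint union contained in [D]. It is applied to mass, energy
    and enclosed volume alike. *)
Lemma sum_integral_disjoint d (T : measurableType d) (R : realType)
    (mu : {measure set T -> \bar R}) (D : set T) (f : T -> \bar R) n
    (F : 'I_n -> set T) :
  measurable D -> measurable_fun D f -> (forall x, D x -> 0 <= f x)%E ->
  (forall i, measurable (F i)) -> trivIset setT F ->
  (\sum_(i < n) \int[mu]_(x in D `&` F i) f x <= \int[mu]_(x in D) f x)%E.
Proof.
move=> mD mf f0 mF tF.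
have mDF i : measurable (D `&` F i) by exact: measurableI.
have sub : \big[setU/set0]_(i < n) (D `&` F i) `<=` D.
  apply: (big_ind (fun A => A `<=` D)) => [|A B AD BD|i _]; first exact: sub0set.
    by rewrite subUset.
  exact: subIsetl.
rewrite -ge0_integral_bigsetU//; last 4 first.
- exact: index_enum_uniq.
- by apply: trivIset_setIl; apply: sub_trivIset tF.
- apply: measurable_funS mf => //.
- by move=> x /sub; exact: f0.
apply: ge0_subset_integral => //.
exact: bigsetU_measurable.
Qed.

(** Any constant below 1 would do for small radii; 96/100 is the loss budgeted in
    [density_lower_bound]. *)
Lemma density_ratio_lower_bound (R : realType) (mu : {measure set (borel 'rV[R]_3) -> \bar R})
    (x : 'rV[R]_3) :
  cvg (density_ratio mu x @ 0^'+) -> (1 <= density2 mu x)%E ->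
  exists2 d : R, 0 < d & forall r, 0 < r < d ->
    ((96 / 100 * pi * r ^+ 2)%:E <= mu (ecball x r))%E.
Proof.
move=> cmu mu1.
have /cmu : nbhs (density2 mu x) [set y | (96 / 100)%:E < y]%E.
  apply: open_nbhs_nbhs; split; first exact: open_ereal_gt_ereal.
  by apply: lt_le_trans mu1; rewrite lte_fin; lra.
move=> [d /= d0 dmu]; exists d => // r /andP[r0 rd].
have : ((96 / 100)%:E < density_ratio mu x r)%E.
  by apply: dmu => //=; rewrite sub0r normrN gtr0_norm.
rewrite /density_ratio.
have pr0 : 0 < pi * r ^+ 2 :> R by rewrite mulr_gt0 ?pi_gt0 ?exprn_gt0.
case: (mu _) => [m| |] //=.
- by rewrite -EFinM lte_fin ltr_pdivlMr// lee_fin mulrA => /ltW.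
- by rewrite leey.
- by rewrite gt0_mulNye ?lte_fin ?invr_gt0.
Qed.

Lemma spt_nbhs_gt0 (R : realType) (T : ptopologicalType)
    (mu : {measure set (borel T) -> \bar R}) (U : set T) x :
  spt mu x -> open U -> U x -> (0 < mu U)%E.
Proof.
move=> sx oU Ux; rewrite lt_neqAle measure_ge0 andbT; apply/eqP => U0.
by apply: sx; exists U.
Qed.

Lemma closed_spt (R : realType) (T : ptopologicalType) (mu : set T -> \bar R) :
  closed (spt mu).
Proof. by rewrite closedC; apply: bigcup_open => U []. Qed.

(** An open set meeting the support has positive measure, so it cannot lie in the exceptional null
    set. *)
Lemma ae_dense_spt (R : realType) (T : ptopologicalType)
    (mu : {measure set (borel T) -> \bar R}) (P : T -> Prop) (U : set T) x :
  {ae mu, forall y, P y} -> spt mu x -> open U -> U x -> exists2 y, U y & P y.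
Proof.
move=> [N [mN N0 PN]] sx oU Ux; apply: contrapT => noP.
have := spt_nbhs_gt0 _ _ _ _ _ sx oU Ux; rewrite lt_neqAle => /andP[/eqP + _].
apply; apply/esym/eqP; rewrite -measure_le0 -N0 le_measure ?inE//.
  exact: sub_sigma_algebra.
by move=> y Uy; apply: PN => /= Py; apply: noP; exists y.
Qed.

(** The distances to [p] form a connected subset of the line, hence an interval containing 0 and
    [enorm (x - p)]. *)
Lemma connected_enorm_ivt (R : realType) (S : set 'rV[R]_3) (p x : 'rV[R]_3) (t : R) :
  connected S -> S p -> S x -> 0 <= t <= enorm (x - p) ->
  exists2 y, S y & enorm (y - p) = t.
Proof.
move=> cS Sp Sx t01.
have ce : continuous (fun y : 'rV[R]_3 => enorm (y - p)).
  by move=> y; exact: (continuous_comp (continuous_sqdist p y) (@sqrt_continuous R _)).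
have /connected_intervalP itv : connected ((fun y => enorm (y - p)) @` S).
  by apply: connected_continuous_connected => //; exact: continuous_subspaceT.
have p0 : enorm (p - p) = 0 by rewrite subrr /enorm /dot big1 ?sqrtr0// => i _; rewrite mxE mul0r.
have : ((fun y => enorm (y - p)) @` S) t.
  by apply: (itv 0 (enorm (x - p))) => //; [exists p|exists x].
by move=> [y Sy <-]; exists y.
Qed.

(** * Separated centres and the final optimisation *)

Section DiameterBound.
Context {R : realType}.

(** Points of [S] at distances i l / M from [p], for i = 0, ..., M, are moved slightly to points
    satisfying [P]; their distances to [p] alone keep them apart. *)
Lemma separated_points (S : set 'rV[R]_3) (P : 'rV[R]_3 -> Prop)
    (p x : 'rV[R]_3) (M : nat) (r : R) :
  connected S -> S p -> S x -> (0 < M)%N ->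
  (forall y t, S y -> 0 < t -> exists2 z, enorm (z - y) < t & P z) ->
  0 < r -> 2 * r * M%:R < enorm (x - p) ->
  exists z : 'I_M.+1 -> 'rV[R]_3, (forall i, P (z i)) /\
    trivIset setT (fun i => [set w | enorm (w - z i) < r]).
Proof.
move=> cS Sp Sx M0 dense r0; set l := enorm (x - p) => rl.
have M0' : 0 < M%:R :> R by rewrite ltr0n.
(* Half the slack: after both centres have moved by less than [t], a distance of l / M - 2 t = 2 r
   remains. *)
pose t := (l / M%:R - 2 * r) / 2.
have t0 : 0 < t by rewrite divr_gt0// subr_gt0 ltr_pdivlMr.
have /choice[z zP] : forall i : 'I_M.+1, exists z,
    P z /\ `|enorm (z - p) - l / M%:R * i%:R| < t.
  move=> i.
  have [|y Sy yi] := @connected_enorm_ivt _ S p x (l / M%:R * i%:R) cS Sp Sx.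
    rewrite mulr_ge0 ?divr_ge0 ?enorm_ge0//= -/l mulrAC ler_pdivrMr//.
    by rewrite ler_wpM2l ?enorm_ge0// ler_nat -ltnS.
  have [w wy Pw] := dense y t Sy t0; exists w; split => //.
  rewrite -yi ltr_norml; apply/andP; split.
    have := ler_enormD (y - w) (w - p); rewrite addrA subrK.
    by rewrite -[enorm (y - w)]enormN opprB; lra.
  by have := ler_enormD (w - y) (y - p); rewrite addrA subrK; lra.
exists z; split => [i|]; first by have [] := zP i.
have far (i j : 'I_M.+1) : (i < j)%N -> 2 * r <= enorm (z j - z i).
  move=> ij.
  have [_] := zP i; have [_] := zP j; rewrite !ltr_norml => /andP[zj _] /andP[_ zi].
  have ijM : l / M%:R * i%:R + l / M%:R <= l / M%:R * j%:R.
    rewrite -[X in _ + X]mulr1 -mulrDr ler_wpM2l ?divr_ge0 ?enorm_ge0//.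
    by rewrite natr1 ler_nat.
  have := ler_enormD (z j - z i) (z i - p); rewrite addrA subrK.
  move: zj zi ijM t0; rewrite /t; lra.
have disj (i j : 'I_M.+1) w : enorm (w - z i) < r -> enorm (w - z j) < r -> ~~ (i < j)%N.
  move=> wi wj; apply/negP => /far.
  have := ler_enormD (z j - w) (w - z i); rewrite addrA subrK.
  by rewrite -[enorm (z j - w)]enormN opprB; lra.
apply/trivIsetP => i j _ _ ij; apply/seteqP; split => // w [/= wi wj].
have := disj _ _ _ wi wj; have := disj _ _ _ wj wi; rewrite -!leqNgt => ji ij'.
by move/eqP: ij; apply; apply/val_inj/eqP; rewrite eqn_leq ij' ji.
Qed.

(** Here [c] stands for pi, [l] for a distance and [W] for the energy; [a] and [A] are the mass plus
    |c0|, respectively 2/3 |c0|, times the volume. The last hypothesis is the inequality summed over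
    M + 1 balls. *)
Lemma diameter_arithmetic (c l a A W : R) : 0 < c -> 0 < l ->
  0 <= A -> a <= 3 / 2 * A -> 8 / 5 * c <= W / 2 ->
  (forall M, (0 < M)%N -> M.+1%:R * (8 / 5 * c) <=
     4 / (49 / 50 * l / (2 * M%:R)) ^+ 2 * a + W / 2) ->
  l <= 9 / (2 * c) * Num.sqrt (W * A).
Proof.
move=> c0 l0 A0 aA W0 HM.
(* M is about 2t, which minimises M^2 / (M - t). *)
pose t := W / 2 / (8 / 5 * c) - 1.
have c85 : 0 < 8 / 5 * c by rewrite mulr_gt0//; lra.
have t0 : 0 <= t by rewrite subr_ge0 ler_pdivlMr// mul1r.
have WE : W = 16 / 5 * c * (t + 1).
  by rewrite /t subrK; field; rewrite gt_eqF.
(* The successor keeps [M] positive when [t] is 0 and gives 2 t <= M <= 2 t + 1. *)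
pose M := (Num.truncn (2 * t)).+1.
have M2 : 2 * t <= M%:R by rewrite ltW// truncnS_gt.
have M1 : M%:R <= 2 * t + 1.
  by rewrite /M -natr1 lerD2r truncn_le mulr_ge0.
have M0 : 0 < M%:R :> R by rewrite ltr0n.
have := HM M (ltn0Sn _).
have -> : 4 / (49 / 50 * l / (2 * M%:R)) ^+ 2 =
    M%:R ^+ 2 * 16 / ((49 / 50) ^+ 2 * l ^+ 2).
  by field; rewrite !gt_eqF.
rewrite -natr1.
have -> : W / 2 = (8 / 5 * c) * (t + 1) by rewrite WE; field.
move=> HM'.
have l20 : 0 < l ^+ 2 by rewrite exprn_gt0.
move: HM'; set L := (49 / 50) ^+ 2 * l ^+ 2 => HM'.
have L0 : 0 < L by rewrite mulr_gt0// exprn_gt0//; lra.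
have {HM'} : M%:R / 2 * (8 / 5 * c) * L <= M%:R ^+ 2 * 16 * (3 / 2 * A).
  rewrite -ler_pdivlMr// mulrAC.
  have : M%:R ^+ 2 * 16 / L * a <= M%:R ^+ 2 * 16 / L * (3 / 2 * A).
    by rewrite ler_wpM2l// !mulr_ge0 ?invr_ge0 ?sqr_ge0// ltW.
  (* Moving [W / 2] to the left leaves the factor M - t, which is at least M / 2. *)
  have : M%:R / 2 * (8 / 5 * c) <= (M%:R - t) * (8 / 5 * c).
    by rewrite ler_wpM2r ?(ltW c85)//; lra.
  by move: HM'; rewrite mulrDl mul1r [_ * (t + 1)]mulrDr mulr1 mulrBl
    [t * _]mulrC; lra.
have -> : M%:R / 2 * (8 / 5 * c) * L = M%:R * (4 / 5 * c * L) by field.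
have -> : M%:R ^+ 2 * 16 * (3 / 2 * A) = M%:R * (24 * A * M%:R) by field.
rewrite ler_pM2l// => lM.
have lA : 4 / 5 * c * L <= 48 * A * (t + 1).
  have : 24 * A * M%:R <= 24 * A * (2 * (t + 1)).
    by rewrite ler_wpM2l ?mulr_ge0//; lra.
  by lra.
have WA0 : 0 <= W * A.
  apply: mulr_ge0 => //; rewrite WE; apply: mulr_ge0; last by lra.
  by apply: mulr_ge0; [lra|exact: ltW].
have C0 : 0 <= 9 / (2 * c) :> R by rewrite divr_ge0// mulr_ge0// ltW.
have CS0 : 0 <= 9 / (2 * c) * Num.sqrt (W * A).
  by apply: mulr_ge0 => //; exact: sqrtr_ge0.
rewrite -(@ler_pXn2r _ 2)// ?nnegrE ?(ltW l0)//.
rewrite exprMn sqr_sqrtr// -(@ler_pM2l _ (4 / 5 * c * (49 / 50) ^+ 2)); last first.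
  by rewrite !mulr_gt0 ?exprn_gt0//; lra.
rewrite [leLHS](_ : _ = 4 / 5 * c * L); last by rewrite /L; ring.
apply: le_trans lA _.
have -> : 4 / 5 * c * (49 / 50) ^+ 2 * ((9 / (2 * c)) ^+ 2 * (W * A)) =
    (1296 / 25 * (49 / 50) ^+ 2) * A * (t + 1).
  by rewrite WE; field; rewrite gt_eqF.
(* What remains is 48 <= 1296/25 (49/50)^2, which is about 49.8. *)
by rewrite !ler_wpM2r//; lra.
Qed.

End DiameterBound.

(** * Summation over disjoint balls *)

Section EnergyInequality.
Context {R : realType} (V : {measure set (borel (G2o R)) -> \bar R})
  (H : 'rV[R]_3 -> 'rV[R]_3) (E : set (lebesgue3_type R))
  (Theta : lebesgue3_type R -> nat) (c0 : R).
Context (hV : varifold_with_enclosed_volume V H E Theta).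
Context (hmass : (weight V setT < +oo)%E).
Context (hhelfrich : (helfrich V H c0 < +oo)%E).
Context (hTheta : (@lebesgue3 R).-integrable E (fun x => (Theta x)%:R%:E)).
Context (hc0 : c0 <= 0).

Local Notation h z := (H z.1 - c0 *: star (sval z.2)).
Local Notation ball2 x q := [set w : 'rV[R]_3 | dot (w - x) (w - x) < q].
Local Notation density_ge1 x := (cvg (density_ratio (weight V) x @ 0^'+) /\
  (1 <= density2 (weight V) x)%E).

Lemma energy_inequality_at x q : density_ge1 x -> 0 < q ->
  ((8 / 5 * pi)%:E <= (4 / q)%:E * weight V (ball2 x q) +
    (8^-1)%:E * \int[V]_(z in fst @^-1` ball2 x q) (enorm (h z) ^+ 2)%:E +
    (4 / q * `|c0|)%:E *
      \int[@lebesgue3 R]_(y in E `&` ball2 x q) (Theta y)%:R%:E)%E.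
Proof.
move=> [cx dx] q0.
have [d d0 dV] := density_ratio_lower_bound _ _ _ cx dx.
have [eps eps0 dens] := density_lower_bound _ _ _ _ q0 d0 dV.
apply: le_trans (monotonicity_inequality V H E Theta c0 hV hmass hhelfrich
  hTheta hc0 x q eps q0 eps0).
rewrite (_ : 8 / 5 * pi = 2 * (4 / 5 * pi)); last by rewrite mulrA; congr (_ * _); lra.
by rewrite EFinM lee_wpmul2l// lee_fin.
Qed.

(** The local terms on disjoint balls add up to at most the global ones; the energy integral is 4
    times the Helfrich energy, so its coefficient 1/8 becomes 1/2. *)
Lemma energy_inequality_disjoint n (z : 'I_n -> 'rV[R]_3) q : 0 < q ->
  (forall i, density_ge1 (z i)) -> trivIset setT (fun i => ball2 (z i) q) ->
  n%:R * (8 / 5 * pi) <= 4 / q *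
    (fine (weight V setT) + `|c0| * fine (algebraic_volume E Theta)) +
    fine (helfrich V H c0) / 2.
Proof.
move=> q0 dz tz.
have mE := evol_measurable_E hV.
have q4 : 0 <= 4 / q by rewrite divr_ge0// ltW.
have cq0 : 0 <= 4 / q * `|c0| by rewrite mulr_ge0.
have mB i := measurable_sqdist_lt (z i) q.
have mfB i : measurable (fst @^-1` ball2 (z i) q : set (borel (G2o R))).
  by rewrite -[X in measurable X]setTI; exact: (@measurable_fst_borel R).
(* Mass is written as the integral of 1 so that [sum_integral_disjoint] applies. *)
have sum_mass : (\sum_(i < n) weight V (ball2 (z i) q) <= weight V setT)%E.
  have mass1 A : measurable A -> weight V A = (\int[weight V]_(x in A) cst 1 x)%E.
    by move=> mA; rewrite integral_cst// mul1e.
  rewrite (mass1 setT)//.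
  under eq_bigr do rewrite -(setTI (ball2 _ _)) mass1 ?setTI//.
  under eq_bigr do rewrite -(setTI (ball2 _ _)).
  by apply: sum_integral_disjoint.
have sum_energy : (\sum_(i < n)
    \int[V]_(w in fst @^-1` ball2 (z i) q) (enorm (h w) ^+ 2)%:E <=
    \int[V]_w (enorm (h w) ^+ 2)%:E)%E.
  under eq_bigr do rewrite -[fst @^-1` _]setTI.
  apply: (@sum_integral_disjoint _ _ _ V setT _ n (fun i => fst @^-1` ball2 (z i) q)) => //.
  - apply/measurable_EFinP; exact: (measurable_energy V H E Theta c0 hV).
  - by move=> w _; rewrite lee_fin sqr_ge0.
  - by move=> i j _ _ [w [wi wj]]; apply: tz => //; exists w.1.
have sum_volume : (\sum_(i < n)
    \int[@lebesgue3 R]_(y in E `&` ball2 (z i) q) (Theta y)%:R%:E <=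
    algebraic_volume E Theta)%E.
  have mBl i : measurable (ball2 (z i) q : set (lebesgue3_type R)).
    exact: borel_lebesgue3_measurable (mB i).
  have Theta0 x : E x -> (0 <= (Theta x)%:R%:E :> \bar R)%E by rewrite lee_fin.
  exact: sum_integral_disjoint mE (measurable_int _ hTheta) Theta0 mBl tz.
have mass_fin : weight V setT \is a fin_num by rewrite ge0_fin_numE.
have volume_fin : algebraic_volume E Theta \is a fin_num.
  exact: integrable_fin_num hTheta.
have energyE : (\int[V]_w (enorm (h w) ^+ 2)%:E)%E = (4 * fine (helfrich V H c0))%:E.
  have := integrable_fin_num measurableT (integrable_energy V H E Theta c0 hV hhelfrich).
  rewrite /helfrich; case: (integral _ _ _) => //= r _.
  by congr _%:E; field.
rewrite -lee_fin.
have -> : (n%:R * (8 / 5 * pi))%:E = (\sum_(i < n) (8 / 5 * pi)%:E)%E :> \bar R.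
  by rewrite sumEFin sumr_const card_ord mulr_natl.
apply: le_trans (lee_sum _ (fun i _ => energy_inequality_at _ _ (dz i) q0)) _.
rewrite !big_split /=.
apply: (@le_trans _ _ ((4 / q)%:E * weight V setT +
    (8^-1)%:E * \int[V]_w (enorm (h w) ^+ 2)%:E +
    (4 / q * `|c0|)%:E * algebraic_volume E Theta)%E).
  apply: leeD; first apply: leeD.
  - by rewrite -ge0_sume_distrr// lee_wpmul2l// lee_fin.
  - rewrite -ge0_sume_distrr ?lee_wpmul2l ?lee_fin// => i _.
    by apply: integral_ge0 => w _; rewrite lee_fin sqr_ge0.
  - rewrite -ge0_sume_distrr ?lee_wpmul2l ?lee_fin// => i _.
    by apply: integral_ge0 => w _; rewrite lee_fin.
rewrite energyE; move: mass_fin volume_fin.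
case: (weight V setT) => // m _; case: (algebraic_volume E Theta) => // v _.
rewrite -!EFinM -!EFinD lee_fin /=; set w := fine _; set k := 4 / q.
by rewrite le_eqVlt; apply/orP; left; apply/eqP; field.
Qed.

Lemma helfrich_ge0 : (0 <= helfrich V H c0)%E.
Proof.
by rewrite mule_ge0 ?lee_fin// integral_ge0// => z _; rewrite lee_fin sqr_ge0.
Qed.

(** For each M, the balls around M + 1 separated density points supply one inequality of the family
    optimised in [diameter_arithmetic]. *)
Lemma spt_diameter_bound : {ae weight V, forall x, density_ge1 x} ->
  connected (spt (weight V) : set 'rV[R]_3) ->
  forall p x, spt (weight V) p -> spt (weight V) x ->
  enorm (x - p) <= 9 / (2 * pi) * Num.sqrt (fine (helfrich V H c0) *
    (fine (weight V setT) + 2 / 3 * `|c0| * fine (algebraic_volume E Theta))).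
Proof.
move=> dV cS p x Sp Sx.
have C0 : 0 <= 9 / (2 * pi) :> R by rewrite divr_ge0// mulr_ge0// pi_ge0.
have [l0|l0] := leP (enorm (x - p)) 0.
  by rewrite (le_trans l0)// mulr_ge0 ?sqrtr_ge0.
have ballE y r : 0 < r -> [set w : 'rV[R]_3 | enorm (w - y) < r] = ball2 y (r ^+ 2).
  move=> r0; apply: eq_set => w; apply/propext.
  by rewrite -sqr_enorm ltr_pXn2r// nnegrE ?enorm_ge0// ltW.
have open_ball2 y r : 0 < r -> open [set w : 'rV[R]_3 | enorm (w - y) < r].
  by move=> r0; rewrite ballE//; exact: open_sqdist_lt.
have m0 : 0 <= fine (weight V setT) by rewrite fine_ge0.
have v0 : 0 <= fine (algebraic_volume E Theta).
  by rewrite fine_ge0// integral_ge0// => y _; rewrite lee_fin.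
have W0 : 0 <= fine (helfrich V H c0) by rewrite fine_ge0// helfrich_ge0.
have good y t : spt (weight V) y -> 0 < t ->
    exists2 z, enorm (z - y) < t & density_ge1 z.
  move=> Sy t0; have := ae_dense_spt _ _ _ _ _ _ dV Sy (open_ball2 y t t0).
  by apply; rewrite /= subrr /enorm /dot big1 ?sqrtr0// => i _; rewrite mxE mul0r.
set A := fine (weight V setT) + 2 / 3 * `|c0| * fine (algebraic_volume E Theta).
apply: (@diameter_arithmetic _ _ _
  (fine (weight V setT) + `|c0| * fine (algebraic_volume E Theta))) => //.
- exact: pi_gt0.
- by rewrite addr_ge0 ?mulr_ge0.
- have : 0 <= `|c0| * fine (algebraic_volume E Theta) by rewrite mulr_ge0.
  by rewrite /A; lra.
(* The energy lower bound comes from a single ball that is very large: the term 4 a / q becomes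
   negligible. *)
- have [z _ dz] := good p 1 Sp ltr01; set W := fine (helfrich V H c0).
  rewrite leNgt; apply/negP => WP.
  set a := fine (weight V setT) + `|c0| * fine (algebraic_volume E Theta).
  have a0 : 0 <= a by rewrite addr_ge0 ?mulr_ge0.
  have d0 : 0 < 8 / 5 * pi - W / 2 by rewrite subr_gt0.
  (* For this [q] the term 4 a / q is less than half of the assumed gap, a contradiction; [a + 1]
     avoids a division by zero. *)
  have q0 : 0 < 8 * (a + 1) / (8 / 5 * pi - W / 2) by rewrite divr_gt0//; lra.
  have := @energy_inequality_disjoint 1 (fun=> z) _ q0 (fun=> dz).
  have t1 : trivIset setT (fun _ : 'I_1 =>
      ball2 z (8 * (a + 1) / (8 / 5 * pi - W / 2))).
    by move=> i j _ _ _; rewrite !ord1.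
  move=> /(_ t1); rewrite -/a -/W mul1r leNgt => /negP; apply.
  move: (8 / 5 * pi) WP d0 q0 => c WP d0 q0.
  rewrite -ltrBrDr [ltLHS](_ : _ = (c - W / 2) * (a / (2 * (a + 1)))); last first.
    by field; rewrite !gt_eqF//; lra.
  by rewrite -[ltRHS]mulr1 ltr_pM2l// ltr_pdivrMr; lra.
(* The factor 49/50 gives the strict inequality 2 r M < l that leaves room for moving the
   centres. *)
- move=> M M0; set r := 49 / 50 * enorm (x - p) / (2 * M%:R).
  have M0' : 0 < M%:R :> R by rewrite ltr0n.
  have r0 : 0 < r by rewrite divr_gt0 ?mulr_gt0//; lra.
  have rl : 2 * r * M%:R < enorm (x - p).
    rewrite [ltLHS](_ : _ = 49 / 50 * enorm (x - p)); first by lra.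
    by rewrite /r; field; rewrite gt_eqF.
  have [z [dz tz]] := @separated_points _ _ (fun z => density_ge1 z) _ _ _ _ cS Sp Sx M0 good r0 rl.
  have r20 : 0 < r ^+ 2 by rewrite exprn_gt0.
  apply: (energy_inequality_disjoint _ _ _ r20 dz).
  by under eq_fun do rewrite -ballE//.
Qed.

End EnergyInequality.

(** * Compactness and diameter of the support *)

Local Open Scope ereal_scope.

Theorem lemma6p4 (R : realType)
    (V : {measure set (borel (G2o R)) -> \bar R})
    (H : 'rV[R]_3 -> 'rV[R]_3)
    (E : set (lebesgue3_type R)) (Theta : lebesgue3_type R -> nat) (c0 : R)
    (hV : varifold_with_enclosed_volume V H E Theta)
    (hdensity : {ae weight V, forall x,
       cvg (density_ratio (weight V) x @ 0^'+) /\ 1 <= density2 (weight V) x})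
    (hconnected : connected (spt (weight V) : set 'rV[R]_3))
    (hc0 : (c0 <= 0)%R)
    (hhelfrich : helfrich V H c0 < +oo)
    (hmass : weight V setT < +oo)
    (hTheta : (@lebesgue3 R).-integrable E (fun x => (Theta x)%:R%:E))
    (hpotential : {ae weight V, forall x0 : 'rV[R]_3,
       \int[@lebesgue3 R]_(x in E)
         ((Theta x)%:R / enorm (x - x0) ^+ 2)%:E < +oo}) :
  compact (spt (weight V) : set 'rV[R]_3) /\
  diam (spt (weight V)) <=
    (9 / (2 * pi))%:E *
    sqrte (helfrich V H c0 *
      (weight V setT + (2 / 3 * `|c0|)%:E * algebraic_volume E Theta)).
Proof.
have bound := spt_diameter_bound V H E Theta c0 hV hmass hhelfrich hTheta hc0
  hdensity hconnected.
have C0 : (0 <= 9 / (2 * pi) :> R)%R by rewrite divr_ge0// mulr_ge0// pi_ge0.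
have volume_fin : algebraic_volume E Theta \is a fin_num.
  have mE := evol_measurable_E hV; exact: integrable_fin_num hTheta.
have mass_fin : weight V setT \is a fin_num by rewrite ge0_fin_numE.
have helfrich_fin : helfrich V H c0 \is a fin_num.
  by rewrite ge0_fin_numE// helfrich_ge0.
split.
  (* The pairwise distance bound makes the closed support bounded; an empty support has no base
     point and is treated first. *)
  apply: bounded_closed_compact; last exact: closed_spt.
  have [->|/set0P[p Sp]] := eqVneq (spt (weight V) : set 'rV[R]_3) set0.
    by exists 0%R; split => // M _ x [].
  set C := (9 / (2 * pi) * Num.sqrt _)%R in bound.
  exists (C + `|p|)%R; split; first exact: num_real.
  move=> M CM x Sx; apply: le_trans (ltW CM).
  rewrite -[x](subrK p) (le_trans (ler_normD _ _))// lerD2r.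
  apply: row_norm_le => [|i].
    by rewrite (le_trans (enorm_ge0 (x - p))) ?bound.
  by rewrite (le_trans (coord_le_enorm _ _)) ?bound.
(* All quantities are finite, so the extended square root becomes the real one. *)
rewrite -(fineK helfrich_fin) -(fineK volume_fin) -(fineK mass_fin) -!EFinM.
(* The first case is the value 0 adjoined in [diam]. *)
apply: ub_ereal_sup => _ [->|[x Sx [y Sy <-]]]; rewrite lee_fin.
  by rewrite mulr_ge0// sqrtr_ge0.
exact: bound.
Qed.
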